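(* There exist conformal almost Hermitian manifolds $(M,c,J)$ of real dimension $6$, of type $W_1^c\oplus W_2^c$, which are not closed.
   Context: A conformal almost Hermitian manifold $(M,c,J)$ is a manifold $M$ of real dimension $2n$ with a conformal class $c$ of Riemannian metrics and an almost complex structure $J$ that is orthogonal for one (equivalently every) metric in the class. A Weyl connection $D$ is a torsion-free linear connection preserving the conformal class. For a Weyl connection $D$, $DJ$ is a section of $\Lambda^1\otimes\mathfrak u(M)^\perp$, where $\mathfrak u(M)^\perp$ is the bundle of endomorphisms of $TM$ that are skew for the metrics of $c$ and anticommute with $J$; $\mathfrak u(M)^\perp\cong[[\lambda^{2,0}]]$, the real 2-forms of type $(2,0)+(0,2)$ (up to a weight). In real dimension $2n\ge 6$, $\Lambda^1\otimes[[\lambda^{2,0}]]$ is, as a $U(n)$-module, the direct sum of four irreducible pairwise inequivalent submodules $W_1\oplus W_2\oplus W_3\oplus W_4$, with $W_1\cong[[\lambda^{3,0}]]$ (real 3-forms of type $(3,0)+(0,3)$), $W_2\cong[[U^1]]$ where $\lambda^{1,0}\otimes\lambda^{2,0}\cong\lambda^{3,0}\oplus U^1$, $W_3\cong[[\lambda^{2,1}_0]]$ (real primitive 3-forms of type $(2,1)+(1,2)$), $W_4\cong\Lambda^1$. $(M,c,J)$ is of type $W_1^c\oplus W_2^c$ if for every Weyl connection $D$ (this does not depend on $D$), $DJ$ is a section of $W_1\oplus W_2\oplus W_4$. There is a unique Weyl connection $D^J$, called adapted to $J$, such that the $W_4$-component of $D^JJ$ vanishes. For a metric $g$ in the class with Levi-Civita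 connection $\nabla$, the Lee form of $(D,g)$ is the 1-form $\eta$ measuring the difference between $D$ and $\nabla$ by $\pm(D-\nabla)_XY=\eta(X)Y+\eta(Y)X-g(X,Y)\eta^\sharp$ (sign fixed once and for all); changing $g$ in the class changes $\eta$ by an exact form. $(M,c,J)$ is closed if the Lee form of $(D^J,g)$ is a closed 1-form for some (equivalently every) metric $g$ in the class. *)

(* Defs.v *)
From HB Require Import structures.
From mathcomp Require Import all_boot all_order all_fingroup all_algebra.
From mathcomp Require Import all_classical all_reals all_analysis.
From mathcomp Require Import complex.
Set Implicit Arguments.
Unset Strict Implicit.
Unset Printing Implicit Defensive.
Import Order.TTheory GRing.Theory Num.Theory.
Import numFieldNormedType.Exports.
Local Open Scope classical_set_scope.
Local Open Scope ring_scope.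

Definition partial (R : realType) (d : nat) (i : 'I_d)
    (f : 'rV[R]_d -> R) : 'rV[R]_d -> R :=
  fun x => 'D_(delta_mx 0 i) f x.

Definition partials (R : realType) (d : nat) (s : seq 'I_d)
    (f : 'rV[R]_d -> R) : 'rV[R]_d -> R :=
  foldr (@partial R d) f s.

(* C^infinity on the open set U: all iterated partial derivatives exist and
   are continuous at the points of U. *)
Definition smooth_on (R : realType) (d : nat) (U : set 'rV[R]_d)
    (f : 'rV[R]_d -> R) : Prop :=
  forall (s : seq 'I_d) (x : 'rV[R]_d), U x ->
    {for x, continuous (partials s f)} /\
    forall i : 'I_d, derivable (partials s f) x (delta_mx 0 i).

(* A homeomorphism between the open sets chart_dom and chart_img; the
   values of chart_fun and chart_inv outside of these sets are irrelevant. *)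
Record chart (M : topologicalType) (R : realType) (d : nat) := Chart {
  chart_dom : set M;
  chart_img : set 'rV[R]_d;
  chart_fun : M -> 'rV[R]_d;
  chart_inv : 'rV[R]_d -> M;
  chart_dom_open : open chart_dom;
  chart_img_open : open chart_img;
  chart_funP : forall p, chart_dom p -> chart_img (chart_fun p);
  chart_invP : forall x, chart_img x -> chart_dom (chart_inv x);
  chart_funK : forall p, chart_dom p -> chart_inv (chart_fun p) = p;
  chart_invK : forall x, chart_img x -> chart_fun (chart_inv x) = x;
  chart_fun_cont : forall p, chart_dom p -> {for p, continuous chart_fun};
  chart_inv_cont : forall x, chart_img x -> {for x, continuous chart_inv} }.

Definition overlap (M : topologicalType) (R : realType) (d : nat)
    (u v : chart M R d) : set 'rV[R]_d :=
  [set x | chart_img u x /\ chart_dom v (chart_inv u x)].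

Definition transition (M : topologicalType) (R : realType) (d : nat)
    (u v : chart M R d) (x : 'rV[R]_d) : 'rV[R]_d :=
  chart_fun v (chart_inv u x).

Record manifold (R : realType) (d : nat) := Manifold {
  mfd_space :> topologicalType;
  mfd_hausdorff : hausdorff_space mfd_space;
  mfd_second_countable : @second_countable mfd_space;
  mfd_index : Type;
  mfd_chart : mfd_index -> chart mfd_space R d;
  mfd_cover : forall p : mfd_space, exists i, chart_dom (mfd_chart i) p;
  mfd_compat : forall (i j : mfd_index) (b : 'I_d),
    smooth_on (overlap (mfd_chart i) (mfd_chart j))
      (fun x => transition (mfd_chart i) (mfd_chart j) x 0 b) }.

Definition cimg (R : realType) (d : nat) (M : manifold R d)
    (i : mfd_index M) : set 'rV[R]_d := chart_img (mfd_chart i).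

Definition coverlap (R : realType) (d : nat) (M : manifold R d)
    (i j : mfd_index M) : set 'rV[R]_d :=
  overlap (mfd_chart i) (mfd_chart j).

Definition ctrans (R : realType) (d : nat) (M : manifold R d)
    (i j : mfd_index M) : 'rV[R]_d -> 'rV[R]_d :=
  transition (mfd_chart i) (mfd_chart j).

(* With y = ctrans i j x, the (a, b) entry is dy^b/dx^a: a tangent vector with
   components X in the chart i has components X *m cjac i j x in the chart j. *)
Definition cjac (R : realType) (d : nat) (M : manifold R d)
    (i j : mfd_index M) (x : 'rV[R]_d) : 'M[R]_d :=
  \matrix_(a, b) partial a (fun y => ctrans i j y 0 b) x.

Definition smooth_fun (R : realType) (d : nat) (M : manifold R d)
    (f : M -> R) : Prop :=
  forall i : mfd_index M,
    smooth_on (cimg i) (fun x => f (chart_inv (mfd_chart i) x)).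

(* A field is given by its components in each chart of the atlas, as a
   function of the coordinates.  Tangent vectors are row vectors; a 1-form eta
   is a column, eta(X) = X *m eta; a metric g and an endomorphism J are square
   matrices, g(X, Y) = X *m g *m Y^T and J X = X *m J. *)

Record one_form (R : realType) (d : nat) (M : manifold R d) := OneForm {
  form_comp :> mfd_index M -> 'rV[R]_d -> 'cV[R]_d;
  form_smooth : forall i a, smooth_on (cimg i) (fun x => form_comp i x a 0);
  form_change : forall i j x, coverlap i j x ->
    form_comp i x = cjac i j x *m form_comp j (ctrans i j x) }.

Definition closed_form (R : realType) (d : nat) (M : manifold R d)
    (eta : one_form M) : Prop :=
  forall (i : mfd_index M) (x : 'rV[R]_d) (a b : 'I_d), cimg i x ->
    partial a (fun y => eta i y b 0) x = partial b (fun y => eta i y a 0) x.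

Record metric (R : realType) (d : nat) (M : manifold R d) := Metric {
  metric_comp :> mfd_index M -> 'rV[R]_d -> 'M[R]_d;
  metric_smooth : forall i a b,
    smooth_on (cimg i) (fun x => metric_comp i x a b);
  metric_sym : forall i x, cimg i x -> (metric_comp i x)^T = metric_comp i x;
  metric_pos : forall i x (X : 'rV[R]_d), cimg i x -> X != 0 ->
    0 < (X *m metric_comp i x *m X^T) 0 0;
  metric_change : forall i j x, coverlap i j x ->
    metric_comp i x =
      cjac i j x *m metric_comp j (ctrans i j x) *m (cjac i j x)^T }.

Record almost_complex (R : realType) (d : nat) (M : manifold R d) :=
  AlmostComplex {
  ac_comp :> mfd_index M -> 'rV[R]_d -> 'M[R]_d;
  ac_smooth : forall i a b, smooth_on (cimg i) (fun x => ac_comp i x a b);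
  ac_sqr : forall i x, cimg i x -> ac_comp i x *m ac_comp i x = - 1%:M;
  ac_change : forall i j x, coverlap i j x ->
    ac_comp i x *m cjac i j x = cjac i j x *m ac_comp j (ctrans i j x) }.

(* Christoffel symbols: D_(d_a) d_b = \sum_c (conn_comp i x a) b c d_c. *)
Record connection (R : realType) (d : nat) (M : manifold R d) := Connection {
  conn_comp :> mfd_index M -> 'rV[R]_d -> 'I_d -> 'M[R]_d;
  conn_smooth : forall i a b c,
    smooth_on (cimg i) (fun x => conn_comp i x a b c);
  conn_change : forall i j x a, coverlap i j x ->
    conn_comp i x a *m cjac i j x =
      \matrix_(b, k) partial a (fun y => cjac i j y b k) x
      + \sum_c cjac i j x a c *:
          (cjac i j x *m conn_comp j (ctrans i j x) c) }.

Definition torsion_free (R : realType) (d : nat) (M : manifold R d)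
    (D : connection M) : Prop :=
  forall (i : mfd_index M) (x : 'rV[R]_d) (a b c : 'I_d), cimg i x ->
    D i x a b c = D i x b a c.

(* D_(d_a) g, with (D_Z g)(X, Y) = Z (g(X, Y)) - g(D_Z X, Y) - g(X, D_Z Y). *)
Definition cov_metric (R : realType) (d : nat) (M : manifold R d)
    (D : connection M) (g : metric M) (i : mfd_index M) (x : 'rV[R]_d)
    (a : 'I_d) : 'M[R]_d :=
  \matrix_(b, c) partial a (fun y => g i y b c) x
  - D i x a *m g i x - g i x *m (D i x a)^T.

(* D_(d_a) J, with (D_Z J) Y = D_Z (J Y) - J (D_Z Y). *)
Definition cov_ac (R : realType) (d : nat) (M : manifold R d)
    (D : connection M) (J : almost_complex M) (i : mfd_index M)
    (x : 'rV[R]_d) (a : 'I_d) : 'M[R]_d :=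
  \matrix_(b, c) partial a (fun y => J i y b c) x
  + J i x *m D i x a - D i x a *m J i x.

Definition levi_civita (R : realType) (d : nat) (M : manifold R d)
    (g : metric M) (D : connection M) : Prop :=
  torsion_free D /\ forall i x a, cimg i x -> cov_metric D g i x a = 0.

Definition conformally_equivalent (R : realType) (d : nat) (M : manifold R d)
    (g h : metric M) : Prop :=
  exists f : M -> R, [/\ smooth_fun f, forall p, 0 < f p &
    forall i x, cimg i x -> h i x = f (chart_inv (mfd_chart i) x) *: g i x].

Record conformal_class (R : realType) (d : nat) (M : manifold R d) :=
  ConformalClass {
  cc_set :> metric M -> Prop;
  cc_nonempty : exists g, cc_set g;
  cc_class : forall g h, cc_set g ->
    (cc_set h <-> conformally_equivalent g h) }.

Definition orthogonal_ac (R : realType) (d : nat) (M : manifold R d)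
    (c : conformal_class M) (J : almost_complex M) : Prop :=
  forall g, c g -> forall i x, cimg i x ->
    J i x *m g i x *m (J i x)^T = g i x.

Record conformal_almost_hermitian (R : realType) (d : nat) :=
  ConformalAlmostHermitian {
  cah_mfd :> manifold R d;
  cah_class : conformal_class cah_mfd;
  cah_ac : almost_complex cah_mfd;
  cah_orth : orthogonal_ac cah_class cah_ac }.

Definition weyl (R : realType) (d : nat) (M : manifold R d)
    (c : conformal_class M) (D : connection M) : Prop :=
  torsion_free D /\
  forall g, c g -> exists theta : one_form M,
    forall i x a, cimg i x ->
      cov_metric D g i x a = theta i x a 0 *: g i x.

(* (D - nabla)_X Y = eta(X) Y + eta(Y) X - g(X, Y) eta^#. *)
Definition lee_form (R : realType) (d : nat) (M : manifold R d)
    (D : connection M) (g : metric M) (eta : one_form M) : Prop :=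
  exists2 nabla : connection M, levi_civita g nabla &
    forall i x (X Y : 'rV[R]_d), cimg i x ->
      \sum_a X 0 a *: (Y *m (D i x a - nabla i x a)) =
      (X *m eta i x) 0 0 *: Y + (Y *m eta i x) 0 0 *: X
      - (X *m g i x *m Y^T) 0 0 *: ((eta i x)^T *m invmx (g i x)).

(* From here to sum3, g and J : 'M[R]_d are the values at one point of a metric and
   of an orthogonal almost complex structure. *)

(* K-valued k-tensors on R^d; K is R or R[i]. *)
Definition tensor (K : Type) (R : realType) (d k : nat) : Type :=
  ('I_k -> 'rV[R]_d) -> K.

Definition tensor_product (K : pzRingType) (R : realType) (d k l : nat)
    (P : set (tensor K R d k)) (Q : set (tensor K R d l)) :
    set (tensor K R d (k + l)) :=
  [set B : tensor K R d (k + l) | exists (m : nat) (s : 'I_m -> tensor K R d k)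
             (t : 'I_m -> tensor K R d l),
    [/\ forall e, P (s e), forall e, Q (t e) &
      forall X, B X =
        \sum_e s e (fun u => X (lshift l u)) * t e (fun v => X (rshift k v))]].

(* R-linear complex-valued covectors of type (1,0) (if holo) or (0,1). *)
Definition covector_type (R : realType) (d : nat) (J : 'M[R]_d)
    (holo : bool) (a : 'rV[R]_d -> R[i]) : Prop :=
  (forall (r : R) X Y, a (r *: X + Y) = (r%:C)%C * a X + a Y) /\
  forall X, a (X *m J) = (if holo then 'i%C else - 'i%C) * a X.

(* lambda^{p,q}: the complex span of the wedge products
   a_1 /\ ... /\ a_(p+q), where the first p factors are of type (1,0) and the
   other ones of type (0,1); the value of such a product at (X_1, ..., X_(p+q))
   is the determinant of the matrix of the a_u(X_v). *)
Definition lambda (R : realType) (d : nat) (J : 'M[R]_d) (p q : nat) :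
    set (tensor R[i] R d (p + q)) :=
  [set w : tensor R[i] R d (p + q) | exists (m : nat) (z : 'I_m -> R[i])
             (a : 'I_m -> 'I_(p + q) -> 'rV[R]_d -> R[i]),
    (forall e (u : 'I_(p + q)), covector_type J (u < p)%N (a e u)) /\
    forall X, w X =
      \sum_e z e * \det (\matrix_(u < p + q, v < p + q) a e u (X v))].

(* [[E]], for a complex module E with E \cap \bar E = 0. *)
Definition real_part (R : realType) (d k : nat)
    (E : set (tensor R[i] R d k)) : set (tensor R R d k) :=
  [set B : tensor R R d k | exists2 w, E w & forall X, B X = complex.Re (w X)].

(* U^1: the kernel of the alternation
   lambda^{1,0} \otimes lambda^{2,0} -> lambda^{3,0}. *)
Definition U1 (R : realType) (d : nat) (J : 'M[R]_d) :
    set (tensor R[i] R d 3) :=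
  [set w : tensor R[i] R d 3 | tensor_product (lambda J (p := 1) (q := 0))
             (lambda J (p := 2) (q := 0)) w /\
    forall X, \sum_(s : 'S_3) (-1) ^+ s * w (fun u => X (s u)) = 0].

Definition vec3 (R : realType) (d : nat) (X Y Z : 'rV[R]_d) :
    'I_3 -> 'rV[R]_d :=
  fun u => nth 0 [:: X; Y; Z] u.

(* The rows of E form a g-orthonormal basis; the contraction is the one with
   the fundamental 2-form g(J., .). *)
Definition primitive3 (R : realType) (d : nat) (g J : 'M[R]_d)
    (B : tensor R R d 3) : Prop :=
  forall (E : 'M[R]_d) (X : 'rV[R]_d), E *m g *m E^T = 1%:M ->
    \sum_a B (vec3 (row a E) (row a E *m J) X) = 0.

Definition covectors (R : realType) (d : nat) : set (tensor R R d 1) :=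
  [set B : tensor R R d 1 | exists eta : 'cV[R]_d, forall X, B X = (X 0 *m eta) 0 0].

(* Lambda^1 \otimes [[lambda^{2,0}]]. *)
Definition ambient (R : realType) (d : nat) (J : 'M[R]_d) :
    set (tensor R R d 3) :=
  tensor_product (@covectors R d) (real_part (lambda J (p := 2) (q := 0))).

Definition unitary (R : realType) (d : nat) (g J u : 'M[R]_d) : Prop :=
  u *m g *m u^T = g /\ u *m J = J *m u.

Definition pullback (R : realType) (d k : nat) (u : 'M[R]_d)
    (B : tensor R R d k) : tensor R R d k :=
  fun X => B (fun e => X e *m u).

(* f embeds the U(n)-module N in Lambda^1 \otimes [[lambda^{2,0}]]; the values
   of f outside of N are irrelevant. *)
Definition module_embedding (R : realType) (d k : nat) (g J : 'M[R]_d)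
    (N : set (tensor R R d k)) (f : tensor R R d k -> tensor R R d 3) :
    Prop :=
  [/\ forall B, N B -> ambient J (f B),
      forall (r : R) A B, N A -> N B ->
        f (fun X => r * A X + B X) = (fun X => r * f A X + f B X),
      forall u B, unitary g J u -> N B ->
        f (pullback u B) = pullback u (f B) &
      forall A B, N A -> N B -> f A = f B -> A = B].

(* The submodule of Lambda^1 \otimes [[lambda^{2,0}]] isomorphic to N.  When N
   is one of the four irreducible modules below, it occurs exactly once, so the
   image does not depend on the embedding. *)
Definition submodule_iso (R : realType) (d k : nat) (g J : 'M[R]_d)
    (N : set (tensor R R d k)) : set (tensor R R d 3) :=
  [set B : tensor R R d 3 | exists2 f, module_embedding g J N f &
             exists2 A, N A & B = f A].

Definition W1 (R : realType) (d : nat) (g J : 'M[R]_d) :=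
  submodule_iso g J (real_part (lambda J (p := 3) (q := 0))).

Definition W2 (R : realType) (d : nat) (g J : 'M[R]_d) :=
  submodule_iso g J (real_part (U1 J)).

Definition W3 (R : realType) (d : nat) (g J : 'M[R]_d) :=
  submodule_iso g J
    (real_part (lambda J (p := 2) (q := 1)) `&` [set B | primitive3 g J B]).

Definition W4 (R : realType) (d : nat) (g J : 'M[R]_d) :=
  submodule_iso g J (@covectors R d).

Definition sum3 (R : realType) (d k : nat) (P Q S : set (tensor R R d k)) :
    set (tensor R R d k) :=
  [set B : tensor R R d k | exists B1 B2 B3, [/\ P B1, Q B2, S B3 &
             forall X, B X = B1 X + B2 X + B3 X]].

(* DJ as a tensor: (X, Y, Z) |-> g((D_X J) Y, Z). *)
Definition DJ_tensor (R : realType) (d : nat) (M : manifold R d)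
    (D : connection M) (g : metric M) (J : almost_complex M)
    (i : mfd_index M) (x : 'rV[R]_d) : tensor R R d 3 :=
  fun X => \sum_a X 0 0 a *
    (X 1 *m cov_ac D J i x a *m g i x *m (X 2)^T) 0 0.

Definition type_W1W2 (R : realType) (d : nat)
    (M : conformal_almost_hermitian R d) : Prop :=
  forall D, weyl (cah_class M) D ->
  forall g, cah_class M g -> forall i x, cimg i x ->
    sum3 (W1 (g i x) (cah_ac M i x)) (W2 (g i x) (cah_ac M i x))
         (W4 (g i x) (cah_ac M i x)) (DJ_tensor D g (cah_ac M) i x).

(* D is the Weyl connection adapted to J: as Lambda^1 \otimes [[lambda^{2,0}]]
   is the direct sum of the W_k, the W4-component of DJ vanishes exactly when
   DJ is a section of W1 + W2 + W3. *)
Definition adapted (R : realType) (d : nat)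
    (M : conformal_almost_hermitian R d) (D : connection M) : Prop :=
  weyl (cah_class M) D /\
  forall g, cah_class M g -> forall i x, cimg i x ->
    sum3 (W1 (g i x) (cah_ac M i x)) (W2 (g i x) (cah_ac M i x))
         (W3 (g i x) (cah_ac M i x)) (DJ_tensor D g (cah_ac M) i x).

(* The quantification over D names the unique adapted Weyl connection; as it is
   universal, a manifold which is not closed does have one. *)
Definition is_closed (R : realType) (d : nat)
    (M : conformal_almost_hermitian R d) : Prop :=
  forall D : connection M, adapted D ->
  exists2 g, cah_class M g &
    exists2 eta : one_form M, lee_form D g eta & closed_form eta.

(* Main.v *)
Require Import Defs.
From mathcomp Require Import all_boot all_order all_algebra.
From mathcomp Require Import perm.
From mathcomp Require Import all_classical all_reals all_analysis.
From mathcomp Require Import complex ring lra.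
Set Implicit Arguments.
Unset Strict Implicit.
Unset Printing Implicit Defensive.
Import Order.TTheory GRing.Theory Num.Theory.
Import numFieldNormedType.Exports.
Local Open Scope classical_set_scope.
Local Open Scope ring_scope.

(** The manifold is R^6 with the structure of a two-step nilpotent Lie group.
    In the left-invariant coframe e^1, ..., e^6 one has de^1 = ... = de^4 = 0 and
      de^5 = 2 (e^13 - e^24),   de^6 = - 2 (e^12 + e^34 + e^14 + e^23);
    the metric makes the coframe orthonormal, and J e_1 = e_2, J e_3 = e_4,
    J e_5 = e_6.  The fundamental form Omega = e^12 + e^34 + e^56 satisfies
      d Omega = 2 e^5 /\ Omega + 2 Im ((e^1 + i e^2)(e^3 + i e^4)(e^5 + i e^6)),
    so that d Omega has no primitive (2,1) part: the type is W1 + W2 + W4, and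
    the Lee form is a multiple of e^5, which is not closed.  The (3,0) part is
    essential, since d Omega = theta /\ Omega alone would give
    d theta /\ Omega = 0, hence d theta = 0.

    The proof works with DJ rather than with d Omega.  The adapted connection D
    is the Levi-Civita connection modified by the Lee form - e^5; it has
    constant coefficients in the frame, and a finite computation with integers
    (nabJ_const_J12) shows that T(X, Y, Z) = g((D_X J) Y, Z) satisfies
    T(JX, JY, Z) = - T(X, Y, Z).  Such a T is the real part of a tensor of
    type (1,0) x (2,0); subtracting from the latter its alternation splits T into
    elements of W1 and W2 (split_W1W2), so D is adapted.  For any other Weyl
    connection the Koszul argument gives D' - D in terms of a 1-form, and DJ
    changes by the image of this 1-form under an explicit embedding of Lambda^1
    (DJ_tensor_weyl), that is, by an element of W4.

    Finally Dg determines the Lee form (lee_form_cov_metric): for the metric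
    f g0 it is - (1/2) d (ln f) - e^5.  The second partial derivatives of f
    commute (partial_comm), so the exterior derivative of the Lee form is - de^5
    for every metric of the class, and it does not vanish. *)

(** * Covectors of type (1,0) *)
Section RLinear.
Variables (R : realType) (d : nat) (K : pzRingType) (phi : {rmorphism R -> K}).

(** The morphism phi is the identity of R for real covectors and the inclusion of
    R in R[i] for complex ones. *)
Definition rlinear (a : 'rV[R]_d -> K) : Prop :=
  forall (r : R) X Y, a (r *: X + Y) = phi r * a X + a Y.

Lemma rlinearD a X Y : rlinear a -> a (X + Y) = a X + a Y.
Proof. by move=> la; rewrite -[X]scale1r la rmorph1 mul1r scale1r. Qed.

Lemma rlinear0 a : rlinear a -> a 0 = 0.
Proof. by move=> la; apply: (addrI (a 0)); rewrite -rlinearD // !addr0. Qed.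

Lemma rlinearZ a r X : rlinear a -> a (r *: X) = phi r * a X.
Proof. by move=> la; rewrite -[r *: X]addr0 la rlinear0 // addr0. Qed.

Lemma rlinearN a X : rlinear a -> a (- X) = - a X.
Proof. by move=> la; rewrite -scaleN1r rlinearZ // rmorphN1 mulN1r. Qed.

Lemma rlinear_expand a X : rlinear a ->
  a X = \sum_b phi (X 0 b) * a (delta_mx 0 b).
Proof.
move=> la; rewrite {1}[X]row_sum_delta.
elim/big_rec2: _ => [|b y1 y2 _ <-]; first exact: rlinear0.
exact: la.
Qed.

End RLinear.

Section Expansion.
Variables (R : realType) (d : nat) (J : 'M[R]_d).
Hypothesis J2 : J *m J = - 1%:M.
Local Notation C := R[i].

Lemma mulJJ (X : 'rV[R]_d) : X *m J *m J = - X.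
Proof. by rewrite -mulmxA J2 mulmxN mulmx1. Qed.

Lemma mul_ii : 'i%C * 'i%C = -1 :> C.
Proof. by rewrite -expr2 sqr_i. Qed.

(** The (1,0) part of the complexified b-th coordinate.  These covectors span
    all covectors of type (1,0), with the coefficients of holo_expand; they are
    not linearly independent. *)
Definition holo_coord (b : 'I_d) (X : 'rV[R]_d) : C :=
  2^-1 * ((X 0 b)%:C%C - 'i%C * ((X *m J) 0 b)%:C%C).

Lemma holo_coord_type b : covector_type J true (holo_coord b).
Proof.
split=> [r X Y|X]; rewrite /holo_coord.
  by rewrite mulmxDl -scalemxAl !mxE !rmorphD !rmorphM /=; ring.
rewrite mulJJ [(- X) 0 b]mxE rmorphN /=.
have := mul_ii; set i := 'i%C; move=> ii.
by rewrite mulrCA; congr (_ * _); rewrite mulrBr mulrA ii; ring.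
Qed.

Lemma covector_rlinear h a : covector_type J h a -> rlinear (@real_complex R) a.
Proof. by case. Qed.

Lemma covector_type_opp h a b : covector_type J h a ->
  (forall X, b X = - a X) -> covector_type J h b.
Proof.
by move=> [l c] ba; split=> [r X Y|X]; rewrite !ba ?l ?c ?opprD mulrN.
Qed.

Lemma covector_type_sub h a b : covector_type J h a -> covector_type J h b ->
  covector_type J h (fun X => a X - b X).
Proof.
move=> [la ca] [lb cb]; split=> [r X Y|X]; last by rewrite ca cb mulrBr.
by rewrite la lb; ring.
Qed.

(** A (1,0) covector equals its own (1,0) part, so the real expansion of a in the
    coordinates may be projected to type (1,0) term by term. *)
Lemma holo_expand a X : covector_type J true a ->
  a X = \sum_b holo_coord b X * a (delta_mx 0 b).
Proof.
move=> ha; have la := covector_rlinear ha.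
have {1}-> : a X = 2^-1 * (a X - 'i%C * a (X *m J)).
  by rewrite ha.2 /= mulrA mul_ii mulN1r opprK; field.
rewrite (rlinear_expand X la) (rlinear_expand (X *m J) la).
rewrite mulr_sumr -sumrB mulr_sumr; apply: eq_bigr => b _.
by rewrite /holo_coord mulrA -mulrBl mulrA.
Qed.

End Expansion.

(** * Generators of the spaces of forms *)
Section Determinants.
Variable K : comNzRingType.

Lemma det22 (M : 'M[K]_2) : \det M = M 0 0 * M 1 1 - M 0 1 * M 1 0.
Proof.
pose f (i j : nat) := M (inord i) (inord j).
have E i j : M i j = f i j by rewrite /f !inord_val.
rewrite (expand_det_row _ 0) !big_ord_recl big_ord0 /cofactor !det_mx11 !mxE !E.
by rewrite /=; ring.
Qed.

Lemma det33 (M : 'M[K]_3) : \det M =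
  M 0 0 * (M 1 1 * M 2 2 - M 1 2 * M 2 1)
  - M 0 1 * (M 1 0 * M 2 2 - M 1 2 * M 2 0)
  + M 0 2 * (M 1 0 * M 2 1 - M 1 1 * M 2 0).
Proof.
pose f (i j : nat) := M (inord i) (inord j).
have E i j : M i j = f i j by rewrite /f !inord_val.
rewrite (expand_det_row _ 0) !big_ord_recl big_ord0 /cofactor !det22 !mxE !E.
by rewrite /=; ring.
Qed.

End Determinants.

Section Constructors.
Variables (R : realType) (d : nat) (J : 'M[R]_d).

Lemma sum_enum_val (K : nmodType) (I : finType) (F : I -> K) :
  \sum_(e < #|I|) F (enum_val e) = \sum_e F e.
Proof. by rewrite -big_enum_val. Qed.

(** Sums over an arbitrary finite type are more convenient to produce than sums
    over an ordinal. *)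
Lemma lambdaI p q (I : finType) (z : I -> R[i])
    (a : I -> 'I_(p + q) -> 'rV[R]_d -> R[i]) (w : tensor R[i] R d (p + q)) :
  (forall e (u : 'I_(p + q)), covector_type J (u < p)%N (a e u)) ->
  (forall X, w X =
     \sum_e z e * \det (\matrix_(u < p + q, v < p + q) a e u (X v))) ->
  lambda J (p := p) (q := q) w.
Proof.
move=> ha hw; exists #|I|, (fun e => z (enum_val e)), (fun e => a (enum_val e)).
split=> [e u|X]; first exact: ha.
by rewrite hw -sum_enum_val.
Qed.

Lemma tensor_productI (K : pzRingType) k l (P : set (tensor K R d k))
    (Q : set (tensor K R d l)) (I : finType)
    (s : I -> tensor K R d k) (t : I -> tensor K R d l)
    (B : tensor K R d (k + l)) :
  (forall e, P (s e)) -> (forall e, Q (t e)) ->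
  (forall X, B X =
     \sum_e s e (fun u => X (lshift l u)) * t e (fun v => X (rshift k v))) ->
  tensor_product P Q B.
Proof.
move=> hs ht hB; exists #|I|, (fun e => s (enum_val e)), (fun e => t (enum_val e)).
by split=> [e|e|X]; [exact: hs | exact: ht | rewrite hB -sum_enum_val].
Qed.

Lemma vec3E (X : 'I_3 -> 'rV[R]_d) : X = vec3 (X 0) (X 1) (X 2).
Proof.
apply/funext => -[[|[|[|//]]] hu]; rewrite /vec3 /=;
  by congr X; apply: val_inj.
Qed.

End Constructors.

Section HoloForms.
Variables (R : realType) (d : nat) (J : 'M[R]_d).
Hypothesis J2 : J *m J = - 1%:M.
Local Notation C := R[i].
Local Notation e_ b := (delta_mx 0 b : 'rV[R]_d).
Local Notation holo := (covector_type J true).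
Local Notation zeta := (holo_coord J).

Lemma lambda10I (a : 'rV[R]_d -> C) : holo a ->
  lambda J (p := 1) (q := 0) (fun X => a (X 0)).
Proof.
move=> ha; apply: (@lambdaI R d J 1 0 unit (fun=> 1) (fun _ _ => a)).
  by case=> u; rewrite (ltn_ord u).
by move=> X; rewrite (big_pred1 tt) => [|[]] //; rewrite mul1r det_mx11 mxE.
Qed.

Lemma lambda20I (w : 'rV[R]_d -> 'rV[R]_d -> C) :
  (forall X, holo (w X)) -> (forall X Y, w X Y = - w Y X) ->
  lambda J (p := 2) (q := 0) (fun X => w (X 0) (X 1)).
Proof.
move=> hw alt.
have hw' Y : holo (w^~ Y) := covector_type_opp (hw Y) (alt^~ Y).
have ex X Y : w X Y = \sum_(f : 'I_d * 'I_d) w (e_ f.1) (e_ f.2) *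
                        (zeta f.1 X * zeta f.2 Y).
  rewrite (holo_expand X (hw' Y)) -(pair_bigA _
    (fun b c => w (e_ b) (e_ c) * (zeta b X * zeta c Y))) /=.
  apply: eq_bigr => b _; rewrite (holo_expand Y (hw _)) mulr_sumr.
  by apply: eq_bigr => c _; ring.
apply: (@lambdaI R d J 2 0 ('I_d * 'I_d)%type (fun f => 2^-1 * w (e_ f.1) (e_ f.2))
  (fun f u => if val u == 0 then zeta f.1 else zeta f.2)%N).
  by move=> f u; rewrite (ltn_ord u); case: ifP => _; apply: holo_coord_type.
move=> X.
have -> : w (X 0) (X 1) = 2^-1 * (w (X 0) (X 1) - w (X 1) (X 0)).
  by rewrite [w (X 1) _]alt opprK; field.
rewrite (ex (X 0)) (ex (X 1)) -sumrB mulr_sumr; apply: eq_bigr => f _.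
by rewrite det22 !mxE /=; ring.
Qed.

Lemma sum3_expand (w : 'rV[R]_d -> 'rV[R]_d -> 'rV[R]_d -> C) :
  (forall Y Z, holo (fun X => w X Y Z)) ->
  (forall X Z, holo (fun Y => w X Y Z)) ->
  (forall X Y, holo (fun Z => w X Y Z)) ->
  forall X Y Z, w X Y Z = \sum_(f : 'I_d * 'I_d * 'I_d)
    w (e_ f.1.1) (e_ f.1.2) (e_ f.2) *
      (zeta f.1.1 X * zeta f.1.2 Y * zeta f.2 Z).
Proof.
move=> h1 h2 h3 X Y Z.
rewrite -(pair_bigA _ (fun (f : 'I_d * 'I_d) (c : 'I_d) =>
  w (e_ f.1) (e_ f.2) (e_ c) * (zeta f.1 X * zeta f.2 Y * zeta c Z))) /=.
rewrite -(pair_bigA _ (fun a b => \sum_c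
  w (e_ a) (e_ b) (e_ c) * (zeta a X * zeta b Y * zeta c Z))) /=.
rewrite (holo_expand X (h1 Y Z)); apply: eq_bigr => a _.
rewrite (holo_expand Y (h2 _ Z)) mulr_sumr; apply: eq_bigr => b _.
rewrite (holo_expand Z (h3 _ _)) !mulr_sumr; apply: eq_bigr => c _.
by ring.
Qed.

(** Alternating an expansion in products of coordinates replaces every product by
    a determinant. *)
Lemma alternation_expand (w : 'rV[R]_d -> 'rV[R]_d -> 'rV[R]_d -> C) :
  (forall Y Z, holo (fun X => w X Y Z)) ->
  (forall X Z, holo (fun Y => w X Y Z)) ->
  (forall X Y, holo (fun Z => w X Y Z)) ->
  forall X : 'I_3 -> 'rV[R]_d,
  w (X 0) (X 1) (X 2) + w (X 1) (X 2) (X 0) + w (X 2) (X 0) (X 1)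
  - w (X 1) (X 0) (X 2) - w (X 0) (X 2) (X 1) - w (X 2) (X 1) (X 0) =
  \sum_(f : 'I_d * 'I_d * 'I_d) w (e_ f.1.1) (e_ f.1.2) (e_ f.2) *
    \det (\matrix_(u < 3, v < 3)
      (nth (zeta f.2) [:: zeta f.1.1; zeta f.1.2] u) (X v)).
Proof.
move=> h1 h2 h3 X; rewrite !(sum3_expand h1 h2 h3 (X _)).
rewrite -!big_split -!sumrB; apply: eq_bigr => f _.
by rewrite det33 !mxE /=; ring.
Qed.

(** The sum over S_3 is read off the Leibniz formula of the determinants in
    alternation_expand, which avoids enumerating the permutations. *)
Lemma alternationE (w : 'rV[R]_d -> 'rV[R]_d -> 'rV[R]_d -> C) :
  (forall Y Z, holo (fun X => w X Y Z)) ->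
  (forall X Z, holo (fun Y => w X Y Z)) ->
  (forall X Y, holo (fun Z => w X Y Z)) ->
  forall X : 'I_3 -> 'rV[R]_d,
  \sum_(s : 'S_3) (-1) ^+ s * w (X (s 0)) (X (s 1)) (X (s 2)) =
  w (X 0) (X 1) (X 2) + w (X 1) (X 2) (X 0) + w (X 2) (X 0) (X 1)
  - w (X 1) (X 0) (X 2) - w (X 0) (X 2) (X 1) - w (X 2) (X 1) (X 0).
Proof.
move=> h1 h2 h3 X; rewrite (alternation_expand h1 h2 h3).
under eq_bigr => s _ do rewrite (sum3_expand h1 h2 h3) mulr_sumr.
rewrite exchange_big; apply: eq_bigr => f _.
rewrite /determinant mulr_sumr; apply: eq_bigr => s _.
rewrite mulrCA; congr (_ * (_ * _)).
by rewrite !big_ord_recl big_ord0 !mxE /= mulr1 mulrA;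
  congr (_ * zeta _ (X (s _)) * zeta _ (X (s _)));
  apply: val_inj.
Qed.

Lemma lambda30I (w : 'rV[R]_d -> 'rV[R]_d -> 'rV[R]_d -> C) :
  (forall Y Z, holo (fun X => w X Y Z)) ->
  (forall X Y Z, w X Y Z = - w Y X Z) -> (forall X Y Z, w X Y Z = - w X Z Y) ->
  lambda J (p := 3) (q := 0) (fun X => w (X 0) (X 1) (X 2)).
Proof.
move=> h1 a12 a23.
have h2 X Z : holo (fun Y => w X Y Z).
  exact: covector_type_opp (h1 X Z) (fun Y => a12 X Y Z).
have h3 X Y : holo (fun Z => w X Y Z) := covector_type_opp (h2 X Y) (a23 X Y).
apply: (@lambdaI R d J 3 0 ('I_d * 'I_d * 'I_d)%type
  (fun f => 6^-1 * w (e_ f.1.1) (e_ f.1.2) (e_ f.2))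
  (fun f u => nth (zeta f.2) [:: zeta f.1.1; zeta f.1.2] u)).
  move=> f u; rewrite (ltn_ord u).
  by case: u => [[|[|[|//]]] hu] /=; apply: holo_coord_type.
move=> X; under eq_bigr => f _ do rewrite -mulrA.
rewrite -mulr_sumr -(alternation_expand h1 h2 h3).
rewrite [w (X 1) (X 0) _]a12 [w (X 0) (X 2) _]a23 [w (X 2) (X 1) _]a12.
rewrite [w (X 1) (X 2) _]a23 [w (X 2) (X 0) _]a12 [w (X 1) (X 0) _]a12.
rewrite [w (X 0) (X 2) _]a23.
by field.
Qed.

End HoloForms.

Section Vec3.
Variables (R : realType) (d : nat).
Implicit Types X Y Z : 'rV[R]_d.

Lemma vec3_0 X Y Z : vec3 X Y Z 0 = X. Proof. by []. Qed.
Lemma vec3_1 X Y Z : vec3 X Y Z 1 = Y. Proof. by []. Qed.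
Lemma vec3_2 X Y Z : vec3 X Y Z 2 = Z. Proof. by []. Qed.

Lemma det_vec3 (K : comNzRingType) (a : 'I_3 -> 'rV[R]_d -> K) X Y Z :
  \det (\matrix_(u < 3, v < 3) a u (vec3 X Y Z v)) =
  a 0 X * (a 1 Y * a 2 Z - a 1 Z * a 2 Y)
  - a 0 Y * (a 1 X * a 2 Z - a 1 Z * a 2 X)
  + a 0 Z * (a 1 X * a 2 Y - a 1 Y * a 2 X).
Proof. by rewrite det33 !mxE vec3_0 vec3_1 vec3_2. Qed.

End Vec3.

(** * The submodules W1, W2 and W3 *)
Section Ambient.
Variables (R : realType) (d : nat) (J : 'M[R]_d).
Hypothesis J2 : J *m J = - 1%:M.
Local Notation C := R[i].
Local Notation V := 'rV[R]_d.
Local Notation holo := (covector_type J true).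
Local Notation Re := complex.Re.

(** The intrinsic description of Lambda^1 (x) [[lambda^{2,0}]]: the endomorphism
    of the tangent space defined by the last two slots is skew and anticommutes
    with J. *)
Record is_ambient (t : V -> V -> V -> R) : Prop := IsAmbient {
  amb_lin1 : forall Y Z, rlinear (idfun : {rmorphism R -> R}) (fun X => t X Y Z);
  amb_lin2 : forall X Z, rlinear (idfun : {rmorphism R -> R}) (fun Y => t X Y Z);
  amb_alt : forall X Y Z, t X Y Z = - t X Z Y;
  amb_J : forall X Y Z, t X (Y *m J) Z = t X Y (Z *m J) }.

Lemma ReD (z z' : C) : Re (z + z') = Re z + Re z'.
Proof. by case: z; case: z'. Qed.

Lemma ReN (z : C) : Re (- z) = - Re z.
Proof. by case: z. Qed.

Lemma ReZ (r : R) (z : C) : Re (r%:C%C * z) = r * Re z.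
Proof. by case: z => x y /=; rewrite mul0r subr0. Qed.

Lemma Re_sub_i (r s : R) : Re (r%:C%C - 'i%C * s%:C%C) = r.
Proof. by rewrite /= mul0r mulr0 subr0 oppr0 addr0. Qed.

Lemma amb_lin3 t X Y : is_ambient t ->
  rlinear (idfun : {rmorphism R -> R}) (t X Y).
Proof.
move=> ht r Z Z'; rewrite !(amb_alt ht X Y) (amb_lin2 ht) /=.
by rewrite opprD mulrN.
Qed.

(** In the expansion along the first slot the 2-form t(e_a, ., .) is the real part
    of the (2,0)-form (Y, Z) |-> t(e_a, Y, Z) - i t(e_a, JY, Z). *)
Lemma ambientI t : is_ambient t ->
  ambient J (fun X => t (X 0) (X 1) (X 2)).
Proof.
move=> ht; apply: (@tensor_productI R d R 1 2 _ _ 'I_d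
  (fun a X => X 0 0 a) (fun a X => t (delta_mx 0 a) (X 0) (X 1))).
- move=> a; exists (delta_mx a 0) => X.
  rewrite mxE (bigD1 a) //= !mxE !eqxx mulr1 big1 ?addr0 // => b ba.
  by rewrite mxE (negbTE ba) mulr0.
- move=> a; exists (fun X : 'I_2 -> V => (t (delta_mx 0 a) (X 0) (X 1))%:C%C
      - 'i%C * (t (delta_mx 0 a) (X 0 *m J) (X 1))%:C%C); last first.
    by move=> X; rewrite Re_sub_i.
  apply: (lambda20I J2
    (w := fun Y Z => (t (delta_mx 0 a) Y Z)%:C%C
      - 'i%C * (t (delta_mx 0 a) (Y *m J) Z)%:C%C)).
    move=> Y; split=> [r Z Z'|Z].
      by rewrite !(amb_lin3 _ _ ht) !rmorphD !rmorphM /=; ring.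
    rewrite -!(amb_J ht) mulJJ // (rlinearN _ (amb_lin2 ht _ _)) rmorphN /=.
    by rewrite mulrBr [in RHS]mulrA mul_ii; ring.
  move=> Y Z; rewrite (amb_alt ht _ Y) (amb_alt ht _ _ Z) -(amb_J ht).
  by rewrite !rmorphN /=; ring.
move=> X; rewrite (rlinear_expand _ (amb_lin1 ht _ _)).
by apply: eq_bigr => a _; congr (X _ 0 a * t _ (X _) (X _)); apply: val_inj.
Qed.

Lemma is_ambient_Re (w : V -> V -> V -> C) :
  (forall Y Z, holo (fun X => w X Y Z)) ->
  (forall X Z, holo (fun Y => w X Y Z)) ->
  (forall X Y, holo (fun Z => w X Y Z)) ->
  (forall X Y Z, w X Y Z = - w X Z Y) ->
  is_ambient (fun X Y Z => Re (w X Y Z)).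
Proof.
move=> h1 h2 h3 a23; split=> [Y Z r X X'|X Z r Y Y'|X Y Z|X Y Z].
- by rewrite (h1 Y Z).1 ReD ReZ.
- by rewrite (h2 X Z).1 ReD ReZ.
- by rewrite a23 ReN.
- by rewrite (h2 X Z).2 (h3 X Y).2.
Qed.

Lemma lambda30_alt (w : tensor C R d 3) : lambda J (p := 3) (q := 0) w ->
  [/\ forall Y Z, holo (fun X => w (vec3 X Y Z)),
      forall X Y Z, w (vec3 X Y Z) = - w (vec3 Y X Z) &
      forall X Y Z, w (vec3 X Y Z) = - w (vec3 X Z Y)].
Proof.
case=> m [z [a [ha hw]]]; split=> [Y Z|X Y Z|X Y Z].
- split=> [r X X'|X]; rewrite !hw mulr_sumr -?big_split /=;
    apply: eq_bigr => e _; rewrite !(det_vec3 (a e)).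
    by rewrite (ha e 0).1 (ha e 1).1 (ha e 2).1; ring.
  by rewrite (ha e 0).2 (ha e 1).2 (ha e 2).2 /=; ring.
- rewrite !hw -sumrN; apply: eq_bigr => e _; rewrite !(det_vec3 (a e)); ring.
- rewrite !hw -sumrN; apply: eq_bigr => e _; rewrite !(det_vec3 (a e)); ring.
Qed.

Lemma ambient_lambda30 (B : tensor R R d 3) :
  real_part (lambda J (p := 3) (q := 0)) B -> ambient J B.
Proof.
case=> w hw hB; have [h1 a12 a23] := lambda30_alt hw.
have h2 X Z : holo (fun Y => w (vec3 X Y Z)).
  exact: covector_type_opp (h1 X Z) (fun Y => a12 X Y Z).
have h3 X Y : holo (fun Z => w (vec3 X Y Z)).
  exact: covector_type_opp (h2 X Y) (a23 X Y).
have -> : B = fun X => Re (w (vec3 (X 0) (X 1) (X 2))).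
  by apply/funext => X; rewrite hB {1}[X]vec3E.
exact: ambientI (is_ambient_Re h1 h2 h3 a23).
Qed.

Lemma lambda10_holo (s : tensor C R d 1) :
  lambda J (p := 1) (q := 0) s -> holo (fun X => s (fun=> X)).
Proof.
case=> m [z [a [ha hs]]]; split=> [r X Y|X]; rewrite !hs mulr_sumr -?big_split /=;
  apply: eq_bigr => e _; rewrite !det_mx11 !mxE.
  by rewrite (ha e 0).1; ring.
by rewrite (ha e 0).2 /=; ring.
Qed.

Definition vec2 (X Y : V) : 'I_2 -> V := fun u => nth 0 [:: X; Y] u.

Lemma lambda20_alt (t : tensor C R d 2) : lambda J (p := 2) (q := 0) t ->
  (forall Y, holo (fun X => t (vec2 X Y))) /\
  (forall X Y, t (vec2 X Y) = - t (vec2 Y X)).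
Proof.
have dE (a : 'I_2 -> V -> C) X Y :
    \det (\matrix_(u < 2, v < 2) a u (vec2 X Y v)) =
    a 0 X * a 1 Y - a 0 Y * a 1 X.
  by rewrite det22 !mxE.
case=> m [z [a [ha ht]]]; split=> [Y|X Y].
  split=> [r X X'|X]; rewrite !ht mulr_sumr -?big_split /=;
    apply: eq_bigr => e _; rewrite !(dE (a e)).
    by rewrite (ha e 0).1 (ha e 1).1; ring.
  by rewrite (ha e 0).2 (ha e 1).2 /=; ring.
by rewrite !ht -sumrN; apply: eq_bigr => e _; rewrite !(dE (a e)); ring.
Qed.

Lemma ambient_U1 (B : tensor R R d 3) : real_part (U1 J) B -> ambient J B.
Proof.
case=> w [[m [s [t [hs ht hw]]]] _] hB.
have wE X Y Z : w (vec3 X Y Z) =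
    \sum_e s e (fun=> X) * t e (vec2 Y Z).
  rewrite hw; apply: eq_bigr => e _; congr (s e _ * t e _).
  by apply/funext => -[[|//] hu].
have h1 Y Z : holo (fun X => w (vec3 X Y Z)).
  split=> [r X X'|X]; rewrite !wE mulr_sumr -?big_split /=;
    apply: eq_bigr => e _; have [l c] := lambda10_holo (hs e).
    by rewrite l mulrDl mulrA.
  by rewrite c mulrA.
have h2 X Z : holo (fun Y => w (vec3 X Y Z)).
  split=> [r Y Y'|Y]; rewrite !wE mulr_sumr -?big_split /=;
    apply: eq_bigr => e _; have [/(_ Z) [l c] _] := lambda20_alt (ht e).
    by rewrite l mulrDr mulrCA.
  by rewrite c mulrCA.
have a23 X Y Z : w (vec3 X Y Z) = - w (vec3 X Z Y).
  rewrite !wE -sumrN; apply: eq_bigr => e _.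
  by rewrite (lambda20_alt (ht e)).2 mulrN.
have h3 X Y : holo (fun Z => w (vec3 X Y Z)).
  exact: covector_type_opp (h2 X Y) (a23 X Y).
have -> : B = fun X => Re (w (vec3 (X 0) (X 1) (X 2))).
  by apply/funext => X; rewrite hB {1}[X]vec3E.
exact: ambientI (is_ambient_Re h1 h2 h3 a23).
Qed.

(** W1 and W2 are modelled on spaces of tensors which already lie in the ambient
    module, so the identity is an embedding. *)
Lemma module_embedding_id g (N : set (tensor R R d 3)) :
  N `<=` ambient J -> module_embedding g J N id.
Proof. by move=> hN; split=> [B /hN|||]. Qed.

(** The last identity expresses the type (2,1) + (1,2): of the three ways of
    inserting J in two slots of a product of covectors of types (1,0), (1,0)
    and (0,1), one multiplies it by -1 and the other two by 1. *)
Lemma lambda21_real (B : tensor R R d 3) :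
  real_part (lambda J (p := 2) (q := 1)) B ->
  let b X Y Z := B (vec3 X Y Z) in
  [/\ forall Y Z, rlinear (idfun : {rmorphism R -> R}) (fun X => b X Y Z),
      forall X Y Z, b X Y Z = - b Y X Z,
      forall X Y Z, b X Y Z = - b X Z Y &
      forall X Y Z, b X Y Z = b (X *m J) (Y *m J) Z
        + b (X *m J) Y (Z *m J) + b X (Y *m J) (Z *m J)].
Proof.
case=> w [m [z [a [ha hw]]]] hB b; rewrite /b.
split=> [Y Z r X X'|X Y Z|X Y Z|X Y Z].
- rewrite !hB -ReZ -ReD; congr Re; rewrite !hw mulr_sumr -big_split /=.
  apply: eq_bigr => e _; rewrite !(det_vec3 (a e)).
  by rewrite (ha e 0).1 (ha e 1).1 (ha e 2).1; ring.
- rewrite !hB -ReN; congr Re; rewrite !hw -sumrN.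
  by apply: eq_bigr => e _; rewrite !(det_vec3 (a e)); ring.
- rewrite !hB -ReN; congr Re; rewrite !hw -sumrN.
  by apply: eq_bigr => e _; rewrite !(det_vec3 (a e)); ring.
- rewrite !hB -!ReD; congr Re; rewrite !hw -!big_split.
  apply: eq_bigr => e _; rewrite !(det_vec3 (a e)) /=.
  rewrite !(ha e 0).2 !(ha e 1).2 !(ha e 2).2 /=.
  have := mul_ii R; set i := 'i%C => ii; ring: ii.
Qed.

(** The projection of B on the endomorphisms which anticommute with J, up to a
    factor 2. *)
Definition antiinvariant_part (B : tensor R R d 3) : tensor R R d 3 :=
  fun X => B (vec3 (X 0) (X 1) (X 2))
           - B (vec3 (X 0) (X 1 *m J) (X 2 *m J)).

(** Injectivity: if B(X, Y, Z) = B(X, JY, JZ), then by skew-symmetry the three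
    terms of the last identity of lambda21_real are all equal to B(X, Y, Z),
    whence B = 3 B. *)
Lemma module_embedding_lambda21 g (N : set (tensor R R d 3)) :
  N `<=` real_part (lambda J (p := 2) (q := 1)) ->
  module_embedding g J N antiinvariant_part.
Proof.
move=> hN; split=> [B /hN /lambda21_real /= [l1 a12 a23 _]|||].
- apply: (@ambientI (fun X Y Z =>
    B (vec3 X Y Z) - B (vec3 X (Y *m J) (Z *m J)))).
  have l2 X Z : rlinear (idfun : {rmorphism R -> R}) (fun Y => B (vec3 X Y Z)).
    by move=> r Y Y'; rewrite ![B (vec3 X _ Z)]a12 l1 opprD mulrN.
  have n2 X Y Z : B (vec3 X (- Y) Z) = - B (vec3 X Y Z).
    exact: (rlinearN _ (l2 X Z)).
  have n3 X Y Z : B (vec3 X Y (- Z)) = - B (vec3 X Y Z).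
    by rewrite a23 n2 -a23.
  split=> [Y Z r X X'|X Z r Y Y'|X Y Z|X Y Z].
  + by rewrite !l1 /=; ring.
  + by rewrite mulmxDl -scalemxAl !l2 /=; ring.
  + by rewrite (a23 X Y) (a23 X (Y *m J)); ring.
  + by rewrite !(mulJJ J2) n2 n3; ring.
- by move=> r A B _ _; apply/funext => X; rewrite /antiinvariant_part; ring.
- move=> u B [_ uJ] _; apply/funext => X; rewrite /antiinvariant_part /pullback.
  by congr (B _ - B _); apply/funext => -[[|[|[|//]]] hu]; rewrite /vec3 //=
    -!mulmxA uJ.
- move=> A B hA hB AB; apply/funext => X; rewrite [X]vec3E.
  have [_ a12 a23 e] := lambda21_real (hN _ hA).
  have [_ a12' a23' e'] := lambda21_real (hN _ hB).
  have inv Y1 Y2 Y3 : A (vec3 Y1 Y2 Y3) - B (vec3 Y1 Y2 Y3) =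
      A (vec3 Y1 (Y2 *m J) (Y3 *m J)) - B (vec3 Y1 (Y2 *m J) (Y3 *m J)).
    have := congr1 (@^~ (vec3 Y1 Y2 Y3)) AB.
    by rewrite /antiinvariant_part vec3_0 vec3_1 vec3_2; lra.
  move: (X 0) (X 1) (X 2) => Y1 Y2 Y3.
  have := inv Y1 Y2 Y3; have := inv Y2 Y1 Y3; have := inv Y3 Y1 Y2.
  have := e Y1 Y2 Y3; have := e' Y1 Y2 Y3.
  have := a12 Y1 Y2 Y3; have := a12' Y1 Y2 Y3.
  have := a12 Y1 Y3 Y2; have := a12' Y1 Y3 Y2.
  have := a23 Y1 Y2 Y3; have := a23' Y1 Y2 Y3.
  have := a12 (Y1 *m J) Y2 (Y3 *m J); have := a12' (Y1 *m J) Y2 (Y3 *m J).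
  have := a23 (Y1 *m J) (Y2 *m J) Y3; have := a23' (Y1 *m J) (Y2 *m J) Y3.
  have := a12 (Y1 *m J) Y3 (Y2 *m J); have := a12' (Y1 *m J) Y3 (Y2 *m J).
  lra.
Qed.

End Ambient.

(** * The submodule W4 *)
Section WeylChange.
Variables (R : realType) (d : nat) (g J : 'M[R]_d).
Local Notation V := 'rV[R]_d.
Implicit Types (X Y Z : V) (phi : V -> R).

Definition inner X Y : R := (X *m g *m Y^T) 0 0.

Lemma innerDl X X' Y : inner (X + X') Y = inner X Y + inner X' Y.
Proof. by rewrite /inner !mulmxDl mxE. Qed.

Lemma innerZl r X Y : inner (r *: X) Y = r * inner X Y.
Proof. by rewrite /inner -!scalemxAl mxE. Qed.

(** The variation of g((D_X J) Y, Z) when D_X Y is replaced with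
    D_X Y + phi(X) Y + phi(Y) X - g(X, Y) phi^#; it embeds Lambda^1 in the
    ambient module. *)
Definition weyl_change phi X Y Z : R :=
  phi (Y *m J) * inner X Z - phi (Z *m J) * inner X Y
  - phi Y * inner (X *m J) Z + phi Z * inner (X *m J) Y.

Hypothesis J2 : J *m J = - 1%:M.
Hypothesis gT : g^T = g.
Hypothesis gpos : forall X, X != 0 -> 0 < inner X X.
Hypothesis gJ : J *m g *m J^T = g.

Lemma innerC X Y : inner X Y = inner Y X.
Proof.
have E : X *m g *m Y^T = (Y *m g *m X^T)^T by rewrite !trmx_mul trmxK gT mulmxA.
by rewrite /inner E [LHS]mxE.
Qed.

Lemma innerNl X Y : inner (- X) Y = - inner X Y.
Proof. by rewrite -scaleN1r innerZl mulN1r. Qed.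

Lemma innerJJ X Y : inner (X *m J) (Y *m J) = inner X Y.
Proof.
have E : X *m J *m g *m (Y *m J)^T = X *m (J *m g *m J^T) *m Y^T.
  by rewrite trmx_mul !mulmxA.
by rewrite /inner E gJ.
Qed.

Lemma innerJl X Y : inner (X *m J) Y = - inner X (Y *m J).
Proof. by rewrite -innerJJ mulJJ // innerNl. Qed.

Lemma is_ambient_weyl_change phi :
  rlinear (idfun : {rmorphism R -> R}) phi -> is_ambient J (weyl_change phi).
Proof.
move=> lphi; rewrite /weyl_change.
split=> [Y Z r X X'|X Z r Y Y'|X Y Z|X Y Z] /=.
- by rewrite !mulmxDl -!scalemxAl !innerDl !innerZl; ring.
- rewrite !(innerC X) !(innerC (X *m J)) !mulmxDl -!scalemxAl !innerDl !innerZl.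
  by rewrite !lphi /=; ring.
- by ring.
- rewrite !mulJJ // !(rlinearN _ lphi) !innerJJ.
  by rewrite !innerJl; ring.
Qed.

Lemma orthogonal_vector (m : nat) (B : 'M[R]_(d, m)) : (m < d)%N ->
  exists2 X : V, X != 0 & X *m B = 0.
Proof.
move=> md; have : (0 < \rank (kermx B))%N.
  by rewrite mxrank_ker subn_gt0 (leq_ltn_trans (rank_leq_col B)).
rewrite lt0n mxrank_eq0 => /rowV0Pn [X]; rewrite sub_kermx => /eqP XB X0.
by exists X.
Qed.

(** If X is orthogonal to Z and to JZ, then weyl_change phi X Z X reduces to
    phi(JZ) g(X, X); such an X != 0 exists as soon as d > 2. *)
Lemma weyl_change_inj phi : (2 < d)%N ->
  rlinear (idfun : {rmorphism R -> R}) phi ->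
  (forall X Y Z, weyl_change phi X Y Z = 0) -> forall Y, phi Y = 0.
Proof.
move=> d2 lphi F0 Y.
suff H Z : phi (Z *m J) = 0.
  by rewrite -[Y]opprK -(mulJJ J2) H.
have [X X0] := orthogonal_vector (row_mx (g *m Z^T) (J *m g *m Z^T)) d2.
rewrite mul_mx_row -[RHS]row_mx0 => /eq_row_mx [XZ JXZ].
have XZ0 : inner X Z = 0 by rewrite /inner -mulmxA XZ mxE.
have JXZ0 : inner (X *m J) Z = 0.
  have E : X *m J *m g *m Z^T = X *m (J *m g *m Z^T) by rewrite !mulmxA.
  by rewrite /inner E JXZ mxE.
have JXX : inner (X *m J) X = 0.
  have := innerJl X X; rewrite (innerC X (X *m J)) => H.
  by lra.
have := F0 X Z X; rewrite /weyl_change XZ0 JXZ0 JXX !mulr0 !subr0 addr0.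
by move/eqP; rewrite mulf_eq0 (gt_eqF (gpos X0)) orbF => /eqP.
Qed.

Definition weyl_change_tensor (B : tensor R R d 1) : tensor R R d 3 :=
  fun X : 'I_3 -> V => weyl_change (fun Y => B (fun=> Y)) (X 0) (X 1) (X 2).

Lemma covectors_rlinear (B : tensor R R d 1) : covectors B ->
  rlinear (idfun : {rmorphism R -> R}) (fun X => B (fun=> X)).
Proof. by case=> eta E r X Y; rewrite !E mulmxDl -scalemxAl !mxE. Qed.

Lemma module_embedding_covectors : (2 < d)%N ->
  module_embedding g J (@covectors R d) weyl_change_tensor.
Proof.
move=> d2; split.
- move=> B hB; apply: (ambientI J2 (t := weyl_change _)).
  exact/is_ambient_weyl_change/covectors_rlinear.
- move=> r A B _ _; apply/funext => X.
  by rewrite /weyl_change_tensor /weyl_change; ring.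
- move=> u B [ug uJ] _; apply/funext => X.
  have iu Y Z : inner (Y *m u) (Z *m u) = inner Y Z.
    have E : Y *m u *m g *m (Z *m u)^T = Y *m (u *m g *m u^T) *m Z^T.
      by rewrite trmx_mul !mulmxA.
    by rewrite /inner E ug.
  rewrite /weyl_change_tensor /weyl_change /pullback.
  by rewrite -!mulmxA uJ !mulmxA !iu.
- move=> A B [a hA] [b hB] AB; apply/funext => X.
  have lin : rlinear (idfun : {rmorphism R -> R})
      (fun Y : V => A (fun=> Y) - B (fun=> Y)).
    move=> r Y Z; rewrite (covectors_rlinear (ex_intro _ a hA)).
    by rewrite (covectors_rlinear (ex_intro _ b hB)) /=; ring.
  have := weyl_change_inj d2 lin _ (X 0).
  have -> : X = fun=> X 0 by apply/funext => i; congr X; rewrite ord1.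
  move=> H; apply/eqP; rewrite -subr_eq0; apply/eqP; apply: H => Y1 Y2 Y3.
  have := congr1 (@^~ (vec3 Y1 Y2 Y3)) AB.
  rewrite /weyl_change_tensor vec3_0 vec3_1 vec3_2 /weyl_change.
  set q1 := inner _ _; set q2 := inner _ _.
  set q3 := inner _ _; set q4 := inner _ _.
  by move=> E; rewrite !mulrBl; lra.
Qed.

End WeylChange.

(** * Splitting a tensor into its components *)
Section Decomposition.
Variables (R : realType) (d : nat) (J : 'M[R]_d).
Hypothesis J2 : J *m J = - 1%:M.
Local Notation C := R[i].
Local Notation V := 'rV[R]_d.
Local Notation holo := (covector_type J true).

(** Under these hypotheses t is the real part of w = t - i t(J., ., .), which is of
    type (1,0) in every slot.  One third of the cyclic sum of w is its skew part,
    of type (3,0), and the remainder has zero alternation. *)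
Lemma split_W1W2 (t : V -> V -> V -> R) : is_ambient J t ->
  (forall X Y Z, t (X *m J) (Y *m J) Z = - t X Y Z) ->
  exists B1 B2 : tensor R R d 3,
    [/\ real_part (lambda J (p := 3) (q := 0)) B1, real_part (U1 J) B2 &
        forall X, t (X 0) (X 1) (X 2) = B1 X + B2 X].
Proof.
move=> ht anti.
have tN1 X Y Z : t (- X) Y Z = - t X Y Z := rlinearN X (amb_lin1 ht Y Z).
have tJ12 X Y Z : t (X *m J) Y Z = t X (Y *m J) Z.
  by rewrite -[RHS]opprK -anti mulJJ // (rlinearN Y (amb_lin2 ht _ _)) opprK.
pose w X Y Z : C := (t X Y Z)%:C%C - 'i%C * (t (X *m J) Y Z)%:C%C.
have a23 X Y Z : w X Y Z = - w X Z Y.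
  by rewrite /w (amb_alt ht X) (amb_alt ht (X *m J)) !rmorphN /=; ring.
have h1 Y Z : holo (fun X => w X Y Z).
  split=> [r X X'|X].
    by rewrite /w mulmxDl -scalemxAl !(amb_lin1 ht) !rmorphD !rmorphM /=; ring.
  have := mul_ii R; rewrite /w mulJJ // tN1 rmorphN /=; set i := 'i%C => ii.
  by ring: ii.
have h2 X Z : holo (fun Y => w X Y Z).
  split=> [r Y Y'|Y].
    by rewrite /w !(amb_lin2 ht) !rmorphD !rmorphM /=; ring.
  have := mul_ii R; rewrite /w anti -tJ12 rmorphN /=; set i := 'i%C => ii.
  by ring: ii.
have h3 X Y : holo (fun Z => w X Y Z) := covector_type_opp (h2 X Y) (a23 X Y).
pose w3 X Y Z : C := 3^-1 * (w X Y Z + w Y Z X + w Z X Y).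
have h31 Y Z : holo (fun X => w3 X Y Z).
  split=> [r X X'|X]; rewrite /w3.
    by rewrite (h1 Y Z).1 (h2 Z Y).1 (h3 Y Z).1; ring.
  by rewrite (h1 Y Z).2 (h2 Z Y).2 (h3 Y Z).2 /=; ring.
have a12_3 X Y Z : w3 X Y Z = - w3 Y X Z.
  by rewrite /w3 (a23 X Y) (a23 Y Z) (a23 Z X); ring.
have a23_3 X Y Z : w3 X Y Z = - w3 X Z Y.
  by rewrite /w3 (a23 X Y) (a23 Y Z) (a23 Z X); ring.
pose u X Y Z : C := w X Y Z - w3 X Y Z.
have hu1 Y Z : holo (fun X => u X Y Z) := covector_type_sub (h1 Y Z) (h31 Y Z).
have a23_u X Y Z : u X Y Z = - u X Z Y.
  by rewrite /u a23 a23_3; ring.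
have hu2 X Z : holo (fun Y => u X Y Z).
  apply: covector_type_sub (h2 X Z) _.
  exact: covector_type_opp (h31 X Z) (fun Y => a12_3 X Y Z).
have hu3 X Y : holo (fun Z => u X Y Z) :=
  covector_type_opp (hu2 X Y) (a23_u X Y).
exists (fun X => complex.Re (w3 (X 0) (X 1) (X 2))),
       (fun X => complex.Re (u (X 0) (X 1) (X 2))).
split=> [||X].
- by exists (fun X => w3 (X 0) (X 1) (X 2)); first exact: lambda30I.
- exists (fun X => u (X 0) (X 1) (X 2)) => //; split=> [|X].
    apply: (@tensor_productI R d C 1 2 _ _ 'I_d
      (fun a X => holo_coord J a (X 0)) (fun a X => u (delta_mx 0 a) (X 0) (X 1))).
    + by move=> a; apply: lambda10I; apply: holo_coord_type.
    + by move=> a; apply: (lambda20I J2 (w := u _)).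
    + move=> X; rewrite (holo_expand (X 0) (hu1 _ _)).
      by apply: eq_bigr => a _; congr (holo_coord J a (X _) * u _ (X _) (X _));
        apply: val_inj.
  rewrite (alternationE hu1 hu2 hu3) /u /w3.
  rewrite (a23 (X 0) (X 2)) (a23 (X 1) (X 0)) (a23 (X 2) (X 1)).
  by field.
- by rewrite -ReD /u addrC subrK Re_sub_i.
Qed.

End Decomposition.

Section Types.
Variables (R : realType) (d : nat) (g J : 'M[R]_d).
Hypothesis J2 : J *m J = - 1%:M.
Local Notation V := 'rV[R]_d.
Variable t : V -> V -> V -> R.
Hypothesis ht : is_ambient J t.
Hypothesis anti : forall X Y Z, t (X *m J) (Y *m J) Z = - t X Y Z.

Lemma submodule_iso_id (N : set (tensor R R d 3)) (B : tensor R R d 3) :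
  N `<=` ambient J -> N B -> submodule_iso g J N B.
Proof. by move=> hN hB; exists id; [exact: module_embedding_id | exists B]. Qed.

(** The W3 component is zero; the zero tensor is primitive of type
    (2,1) + (1,2). *)
Lemma sum3_W1W2W3 : sum3 (W1 g J) (W2 g J) (W3 g J)
  (fun X => t (X 0) (X 1) (X 2)).
Proof.
have [B1 [B2 [h1 h2 E]]] := split_W1W2 J2 ht anti.
exists B1, B2, (fun=> 0); split=> [|||X]; last by rewrite E addr0.
- by apply: submodule_iso_id h1; apply: ambient_lambda30.
- by apply: submodule_iso_id h2; apply: ambient_U1.
exists (antiinvariant_part J).
  by apply: (module_embedding_lambda21 J2) => B [].
exists (fun=> 0); last by apply/funext => X; rewrite /antiinvariant_part subr0.
split=> [|E' X _]; last by rewrite big1.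
exists (fun=> 0) => //; exists 0%N, (fun=> 0), (fun _ _ => fun=> 0).
by split=> [[]|X] //; rewrite big_ord0.
Qed.

Lemma sum3_W1W2W4 (phi : 'cV[R]_d) :
  g^T = g -> (forall X : V, X != 0 -> 0 < inner g X X) ->
  J *m g *m J^T = g -> (2 < d)%N ->
  sum3 (W1 g J) (W2 g J) (W4 g J)
    (fun X => t (X 0) (X 1) (X 2) +
      weyl_change g J (fun Y => (Y *m phi) 0 0) (X 0) (X 1) (X 2)).
Proof.
move=> gT gpos gJ d2.
have [B1 [B2 [h1 h2 E]]] := split_W1W2 J2 ht anti.
exists B1, B2, (weyl_change_tensor g J (fun X => (X 0 *m phi) 0 0)).
split=> [|||X]; last by rewrite E.
- by apply: submodule_iso_id h1; apply: ambient_lambda30.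
- by apply: submodule_iso_id h2; apply: ambient_U1.
exists (weyl_change_tensor g J); first exact: module_embedding_covectors.
by exists (fun X => (X 0 *m phi) 0 0) => //; exists phi.
Qed.

End Types.

(** * Smooth functions on R^d *)

(** The balls of radius 1 / (n + 1) around the rational points form a countable
    basis. *)
Lemma rV_second_countable (R : realType) (d : nat) :
  @second_countable 'rV[R]_d.
Proof.
pose U (p : 'rV[rat]_d * nat) : set 'rV[R]_d :=
  ball (map_mx ratr p.1 : 'rV[R]_d) (p.2.+1%:R^-1).
exists (range U).
  exact: (sub_countable (card_image_le _ _) (countableP _)).
split=> [_ [p _ <-]|x V /nbhs_ballP [e /= e0 xeV]]; first exact: ball_open.
have [n ne] : exists n, n.+1%:R^-1 < e / 2 :> R.
  have [|n] := @ltr_add_invr R 0 (e / 2); first by rewrite divr_gt0.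
  by rewrite add0r; exists n.
have n0 : 0 < n.+1%:R^-1 :> R by rewrite invr_gt0.
have qP i : exists q : rat, ball (x 0 i) n.+1%:R^-1 (ratr q : R).
  have [|q] := @rat_in_itvoo R (x 0 i - n.+1%:R^-1) (x 0 i + n.+1%:R^-1).
    by rewrite ltrBlDr -addrA ltrDl addr_gt0.
  rewrite in_itv /= => /andP[q1 q2]; exists q.
  by rewrite /ball /= distrC ltr_distl q1 q2.
pose q : 'rV[rat]_d := \row_i projT1 (cid (qP i)).
have qx : ball (map_mx ratr q : 'rV[R]_d) n.+1%:R^-1 x.
  split=> // i j; rewrite (ord1 i) !mxE; apply: ball_sym.
  exact: projT2 (cid (qP j)).
exists (U (q, n)); first by split=> //; exists (q, n).
move=> y qy; apply: xeV; rewrite /= [e]splitr.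
apply: (@ball_triangle _ _ (map_mx ratr q : 'rV[R]_d)).
  by apply: (le_ball (ltW ne)); apply: ball_sym.
exact: (le_ball (ltW ne)).
Qed.

Section Smooth.
Variables (R : realType) (d : nat).
Local Notation V := 'rV[R]_d.
Implicit Types f g : V -> R.

(** The functions below are smooth on the whole space, where the rules for partial
    derivatives are equalities of functions. *)
Definition smooth f := smooth_on setT f.

Lemma smooth_cts f : smooth f -> continuous f.
Proof. by move=> sf x; have [] := sf [::] x I. Qed.

Lemma smooth_partial f i : smooth f -> smooth (partial i f).
Proof.
move=> sf s x _; have := sf (rcons s i) x I.
by rewrite /partials foldr_rcons.
Qed.

Lemma partial_cst i (c : R) : partial i (fun _ : V => c) = fun=> 0.
Proof. by apply/funext => x; rewrite /partial derive_cst. Qed.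

Lemma derivable_coord a x i : derivable (fun y : V => y 0 a) x (delta_mx 0 i).
Proof.
by have /derivable_mxP := @derivable_id R _ x (delta_mx 0 i : V); apply.
Qed.

Lemma partial_coord i a :
  partial i (fun y : V => y 0 a) = fun=> (i == a)%:R.
Proof.
apply/funext => x; rewrite /partial.
have := derive_mx (@derivable_id R _ x (delta_mx 0 i : V)).
rewrite derive_id => /(congr1 (fun M : V => M 0 a)).
by rewrite !mxE eqxx /= eq_sym => ->.
Qed.

Definition derivable_along (i : 'I_d) f := forall x, derivable f x (delta_mx 0 i).

Lemma smooth_derivable i f : smooth f -> derivable_along i f.
Proof. by move=> sf x; have [_] := sf [::] x I; apply. Qed.

Lemma partialD i f g : derivable_along i f -> derivable_along i g ->
  partial i (fun x => f x + g x) = fun x => partial i f x + partial i g x.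
Proof. by move=> df dg; apply/funext => x; rewrite /partial -deriveD. Qed.

Lemma partialB i f g : derivable_along i f -> derivable_along i g ->
  partial i (fun x => f x - g x) = fun x => partial i f x - partial i g x.
Proof. by move=> df dg; apply/funext => x; rewrite /partial -deriveB. Qed.

Lemma partialM i f g : derivable_along i f -> derivable_along i g ->
  partial i (fun x => f x * g x) =
  fun x => f x * partial i g x + g x * partial i f x.
Proof. by move=> df dg; apply/funext => x; apply: deriveM. Qed.

Lemma partialV i f : derivable_along i f -> (forall x, f x != 0) ->
  partial i (fun x => (f x)^-1) =
  fun x => -1 * ((f x)^-1 * (f x)^-1 * partial i f x).
Proof.
move=> df f0; apply/funext => x; rewrite /partial deriveV //.
by rewrite /GRing.scale /= expr2 invfM mulN1r mulNr.
Qed.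

(** This class is stable under partial derivatives and consists of continuous
    functions with partial derivatives everywhere; by induction on the sequence of
    derivatives, it consists of smooth functions. *)
Inductive smooth_expr : (V -> R) -> Prop :=
| SmoothCst c : smooth_expr (fun=> c)
| SmoothCoord a : smooth_expr (fun x => x 0 a)
| SmoothBase f : smooth f -> smooth_expr f
| SmoothD f g : smooth_expr f -> smooth_expr g -> smooth_expr (fun x => f x + g x)
| SmoothM f g : smooth_expr f -> smooth_expr g -> smooth_expr (fun x => f x * g x)
| SmoothV f : smooth_expr f -> (forall x, f x != 0) ->
    smooth_expr (fun x => (f x)^-1).

Lemma smooth_exprP f : smooth_expr f ->
  [/\ continuous f, forall i, derivable_along i f &
      forall i, smooth_expr (partial i f)].
Proof.
elim=> {f} [c|a|f sf|f g _ [cf df pf] _ [cg dg pg]|f g ef [cf df pf] eg [cg dg pg]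
  |f ef [cf df pf] f0].
- split=> [x|i x|i]; [exact: cst_continuous | exact: derivable_cst |].
  by rewrite partial_cst; apply: SmoothCst.
- split=> [|i x|i]; [exact: coord_continuous | exact: derivable_coord |].
  by rewrite partial_coord; apply: SmoothCst.
- split; [exact: smooth_cts | by move=> i; apply: smooth_derivable |].
  by move=> i; apply/SmoothBase/smooth_partial.
- split=> [x|i x|i]; first by apply: continuousD; [exact: cf | exact: cg].
    by apply: derivableD; [exact: df | exact: dg].
  by rewrite partialD //; apply: SmoothD.
- split=> [x|i x|i]; first by apply: continuousM; [exact: cf | exact: cg].
    exact: (derivableM (df i x) (dg i x)).
  by rewrite partialM //; apply: SmoothD; apply: SmoothM.
- split=> [x|i x|i]; first by apply: continuousV; [exact: f0 | exact: cf].
    exact: (derivableV (f0 x) (df i x)).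
  rewrite partialV //; apply: SmoothM; first exact: SmoothCst.
  by apply: SmoothM => //; apply: SmoothM; apply: SmoothV.
Qed.

Lemma smooth_of_expr f : smooth_expr f -> smooth f.
Proof.
move=> ef s x _; have es : smooth_expr (partials s f).
  by elim: s => [|i s IH] //=; have [] := smooth_exprP IH.
by have [cs ds _] := smooth_exprP es; split=> [|i]; [exact: cs | exact: ds].
Qed.

Lemma smooth_cst (c : R) : smooth (fun=> c).
Proof. exact/smooth_of_expr/SmoothCst. Qed.

Lemma smooth_coord a : smooth (fun x => x 0 a).
Proof. exact/smooth_of_expr/SmoothCoord. Qed.

Lemma smoothD f g : smooth f -> smooth g -> smooth (fun x => f x + g x).
Proof. by move=> sf sg; apply/smooth_of_expr/SmoothD; apply: SmoothBase. Qed.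

Lemma smoothM f g : smooth f -> smooth g -> smooth (fun x => f x * g x).
Proof. by move=> sf sg; apply/smooth_of_expr/SmoothM; apply: SmoothBase. Qed.

Lemma smoothV f : smooth f -> (forall x, f x != 0) -> smooth (fun x => (f x)^-1).
Proof. by move=> sf f0; apply/smooth_of_expr/SmoothV => //; apply: SmoothBase. Qed.

Lemma smooth_sum (I : Type) (r : seq I) (F : I -> V -> R) :
  (forall k, smooth (F k)) -> smooth (fun x => \sum_(k <- r) F k x).
Proof.
move=> sF; elim: r => [|k r IH].
  by under eq_fun do rewrite big_nil; apply: smooth_cst.
by under eq_fun do rewrite big_cons; apply: smoothD.
Qed.

Lemma partial_sum (I : Type) (r : seq I) (F : I -> V -> R) i :
  (forall k, smooth (F k)) ->
  partial i (fun x => \sum_(k <- r) F k x) =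
    fun x => \sum_(k <- r) partial i (F k) x.
Proof.
move=> sF; elim: r => [|k r IH].
  under eq_fun do rewrite big_nil; rewrite partial_cst.
  by under [in RHS]eq_fun do rewrite big_nil.
under eq_fun do rewrite big_cons.
have ss := smooth_sum r sF.
rewrite partialD; [|exact: smooth_derivable|exact: smooth_derivable].
by rewrite IH; under [in RHS]eq_fun do rewrite big_cons.
Qed.

Lemma smooth_onW U f : smooth f -> smooth_on U f.
Proof. by move=> sf s x _; apply: sf. Qed.

End Smooth.

(** * Symmetry of second partial derivatives *)
Section Schwarz.
Variables (R : realType) (d : nat).
Local Notation V := 'rV[R]_d.
Local Notation e_ i := (delta_mx 0 i : V).
Implicit Types f g : V -> R.

Lemma is_derive_line g (v y : V) (s : R) :
  derivable g (y + s *: v) v ->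
  is_derive s 1 (fun r : R => g (y + r *: v)) ('D_v g (y + s *: v)).
Proof.
have E : (fun h : R => h^-1 *: (((fun r : R => g (y + r *: v)) \o shift s) (h *: 1)
      - g (y + s *: v))) =
    (fun h : R => h^-1 *: ((g \o shift (y + s *: v)) (h *: v) - g (y + s *: v))).
  apply/funext => h /=; congr (_ *: (g _ - _)).
  by rewrite [h *: 1]mulr1 scalerDl addrCA.
by move=> dg; apply: DeriveDef; rewrite /derivable /derive E.
Qed.

Lemma mean_value_line i g (y : V) (h : R) : 0 < h -> derivable_along i g ->
  exists2 c, 0 < c < h & g (y + h *: e_ i) - g y = h * partial i g (y + c *: e_ i).
Proof.
move=> h0 dg.
have D s := is_derive_line (dg (y + s *: e_ i)).
have [|c] := MVT h0 (fun s _ => D s).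
  apply: continuous_subspaceT => s.
  by apply/differentiable_continuous/derivable1_diffP; case: (D s).
rewrite in_itv /= scale0r addr0 subr0 => c0h E.
by exists c => //; rewrite E mulrC.
Qed.

Lemma derivable_shift i f (a : V) : derivable_along i f ->
  derivable_along i (fun y => f (y + a)) /\
  partial i (fun y => f (y + a)) = fun y => partial i f (y + a).
Proof.
move=> df.
have E y : (fun h : R => h^-1 *: (((fun y => f (y + a)) \o shift y) (h *: e_ i)
      - f (y + a))) =
    (fun h : R => h^-1 *: ((f \o shift (y + a)) (h *: e_ i) - f (y + a))).
  by apply/funext => h /=; rewrite addrA.
split=> [y|]; first by rewrite /derivable E; apply: df.
by apply/funext => y; rewrite /partial /derive E.
Qed.

(** The mean value theorem, applied to y |-> f(y + h e_j) - f(y) along e_i and then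
    to the i-th partial derivative of f along e_j. *)
Lemma second_difference i j f (x : V) (h : R) : 0 < h -> smooth f ->
  exists2 c : R * R, 0 < c.1 < h /\ 0 < c.2 < h &
    f (x + h *: e_ i + h *: e_ j) - f (x + h *: e_ i) - f (x + h *: e_ j) + f x =
    h * h * partial j (partial i f) (x + c.1 *: e_ i + c.2 *: e_ j).
Proof.
move=> h0 sf.
have [ds ps] := derivable_shift (h *: e_ j) (smooth_derivable (i := i) sf).
have df : derivable_along i f by exact: smooth_derivable.
have dd : derivable_along i (fun y => f (y + h *: e_ j) - f y).
  by move=> y; apply: derivableB; [exact: ds | exact: df].
have [c ch] := mean_value_line x h0 dd.
have [c' ch'] := mean_value_line (x + c *: e_ i) h0
  (smooth_derivable (i := j) (smooth_partial i sf)).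
rewrite (partialB ds df) ps => E' E; exists (c, c') => //=.
by rewrite -mulrA -E' -E; ring.
Qed.

Lemma not_both_close (u v w : R) :
  `|u - w| < `|u - v| / 2 -> `|v - w| < `|u - v| / 2 -> False.
Proof.
move=> uw vw; have := ler_distD w u v; rewrite (distrC w v) => le.
by have := le_lt_trans le (ltrD uw vw); rewrite -splitr ltxx.
Qed.

(** The second difference of f is symmetric in i and j, hence the two mixed
    derivatives agree at two points which are arbitrarily close to x; they are
    continuous at x. *)
Lemma partial_comm i j f : smooth f ->
  partial i (partial j f) = partial j (partial i f).
Proof.
move=> sf; apply/funext => x; apply/eqP; rewrite -subr_eq0 -normr_eq0.
apply/negPn/negP => ne0.
set a := partial i (partial j f); set b := partial j (partial i f).
have eps0 : 0 < `|a x - b x| / 2 by rewrite divr_gt0 // lt_def ne0 normr_ge0.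
have ca : {for x, continuous a}.
  by apply: smooth_cts; apply/smooth_partial/smooth_partial.
have cb : {for x, continuous b}.
  by apply: smooth_cts; apply/smooth_partial/smooth_partial.
move/cvgrPdist_lt : ca => /(_ _ eps0) /nbhs_ballP [r1 /= r10 A].
move/cvgrPdist_lt : cb => /(_ _ eps0) /nbhs_ballP [r2 /= r20 B].
pose N := `|e_ i| + `|e_ j| + 1.
have N0 : 0 < N by rewrite ltr_wpDl // addr_ge0.
pose r := Num.min r1 r2; have r0 : 0 < r by rewrite lt_min r10.
pose h := r / N; have h0 : 0 < h by rewrite divr_gt0.
have near k l (c c' : R) : `|e_ k| + `|e_ l| + 1 = N -> 0 < c < h -> 0 < c' < h ->
    `|x - (x + c *: e_ k + c' *: e_ l)| < r.
  move=> EN /andP[c0 ch] /andP[c'0 c'h].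
  rewrite -addrA opprD addrA subrr sub0r normrN.
  apply: le_lt_trans (ler_normD _ _) _; rewrite !normrZ !gtr0_norm //.
  have -> : r = h * `|e_ k| + h * `|e_ l| + h.
    by rewrite -[X in _ + X]mulr1 -!mulrDr EN divfK // gt_eqF.
  apply: le_lt_trans (_ : h * `|e_ k| + h * `|e_ l| < _); last by rewrite ltrDl.
  by apply: lerD; apply: ler_wpM2r => //; apply: ltW.
have [c1 [c11 c12] E1] := second_difference i j x h0 sf.
have [c2 [c21 c22] E2] := second_difference j i x h0 sf.
have E : a (x + c2.1 *: e_ j + c2.2 *: e_ i) = b (x + c1.1 *: e_ i + c1.2 *: e_ j).
  have h20 : h * h != 0 by rewrite mulf_neq0 // gt_eqF.
  apply: (mulfI h20); apply: etrans (esym E2) _; apply: etrans _ E1.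
  by rewrite (addrAC x); congr (_ + f x); exact: addrAC.
have a2 : `|a x - a (x + c2.1 *: e_ j + c2.2 *: e_ i)| < `|a x - b x| / 2.
  apply: A; rewrite -ball_normE /=; apply: lt_le_trans (near _ _ _ _ _ c21 c22) _.
    by rewrite [`|e_ j| + _]addrC.
  by rewrite ge_min lexx.
have b1 : `|b x - b (x + c1.1 *: e_ i + c1.2 *: e_ j)| < `|a x - b x| / 2.
  apply: B; rewrite -ball_normE /=; apply: lt_le_trans (near i j _ _ erefl c11 c12) _.
  by rewrite ge_min lexx orbT.
rewrite -E in b1; have := not_both_close a2; rewrite b1.
by move=> /(_ isT).
Qed.

End Schwarz.

(** * Fields on R^d in a single chart *)
Section Euclidean.
Variables (R : realType) (d : nat).
Local Notation V := 'rV[R]_d.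

Lemma id_continuous (p : V) : {for p, continuous (id : V -> V)}.
Proof. exact: cvg_id. Qed.

Definition id_chart : chart V R d :=
  @Chart V R d setT setT id id (@openT V) (@openT V) (fun _ h => h)
    (fun _ h => h) (fun _ _ => erefl) (fun _ _ => erefl)
    (fun p _ => @id_continuous p) (fun p _ => @id_continuous p).

Definition euclidean : manifold R d :=
  @Manifold R d V (@norm_hausdorff R V) (@rV_second_countable R d)
    unit (fun=> id_chart) (fun p => ex_intro _ tt I)
    (fun i j b => smooth_onW (smooth_coord b)).
Local Notation M := euclidean.

Lemma cjac_euclidean i j x : @cjac R d M i j x = 1%:M.
Proof.
apply/matrixP => a b; rewrite !mxE.
by rewrite [LHS](congr1 (@^~ x) (partial_coord R a b)).
Qed.

Section Fields.
Variables (h : V -> 'cV[R]_d) (G : V -> 'M[R]_d) (D : V -> 'I_d -> 'M[R]_d).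
Hypothesis hs : forall a, smooth (fun x => h x a 0).
Hypothesis Gs : forall a b, smooth (fun x => G x a b).
Hypothesis Ds : forall a b c, smooth (fun x => D x a b c).

Lemma form_change_id (i j : mfd_index M) x : coverlap i j x ->
  h x = cjac i j x *m h (ctrans i j x).
Proof. by rewrite cjac_euclidean mul1mx. Qed.

Definition euclidean_form : one_form M :=
  @OneForm R d M (fun=> h) (fun _ a => smooth_onW (hs a)) form_change_id.

Lemma metric_change_id (i j : mfd_index M) x : coverlap i j x ->
  G x = cjac i j x *m G (ctrans i j x) *m (cjac i j x)^T.
Proof. by rewrite cjac_euclidean mul1mx trmx1 mulmx1. Qed.

Definition euclidean_metric (GT : forall x, (G x)^T = G x)
    (Gpos : forall x (X : V), X != 0 -> 0 < (X *m G x *m X^T) 0 0) : metric M :=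
  @Defs.Metric R d M (fun=> G) (fun _ a b => smooth_onW (Gs a b))
    (fun _ x _ => GT x) (fun _ x X _ => @Gpos x X) metric_change_id.

Lemma ac_change_id (i j : mfd_index M) x : coverlap i j x ->
  G x *m cjac i j x = cjac i j x *m G (ctrans i j x).
Proof. by rewrite cjac_euclidean mul1mx mulmx1. Qed.

Definition euclidean_ac (G2 : forall x, G x *m G x = - 1%:M) :
    almost_complex M :=
  @AlmostComplex R d M (fun=> G) (fun _ a b => smooth_onW (Gs a b))
    (fun _ x _ => G2 x) ac_change_id.

Lemma conn_change_id (i j : mfd_index M) x a : coverlap i j x ->
  D x a *m cjac i j x =
    \matrix_(b, k) partial a (fun y => cjac i j y b k) x
    + \sum_c cjac i j x a c *: (cjac i j x *m D (ctrans i j x) c).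
Proof.
move=> _; rewrite cjac_euclidean mulmx1.
have -> : \matrix_(b, k) partial a (fun y => @cjac R d M i j y b k) x = 0.
  apply/matrixP => b k; rewrite !mxE.
  under eq_fun do rewrite cjac_euclidean.
  by rewrite partial_cst.
rewrite add0r (bigD1 a) //= big1 => [|c ca].
  by rewrite addr0 mul1mx mxE eqxx scale1r.
by rewrite mxE eq_sym (negbTE ca) scale0r.
Qed.

Definition euclidean_connection : connection M :=
  @Connection R d M (fun=> D) (fun _ a b c => smooth_onW (Ds a b c))
    conn_change_id.

End Fields.

Lemma smooth_fun_euclidean (f : M -> R) : smooth_fun f <-> smooth f.
Proof. by split=> [/(_ tt)|sf i]. Qed.

Lemma smooth_mulmx m n p (A : V -> 'M[R]_(m, n)) (B : V -> 'M[R]_(n, p)) :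
  (forall i j, smooth (fun x => A x i j)) ->
  (forall i j, smooth (fun x => B x i j)) ->
  forall i j, smooth (fun x => (A x *m B x) i j).
Proof.
move=> sA sB i j; under eq_fun do rewrite mxE.
by apply: smooth_sum => k; apply: smoothM.
Qed.

Definition partial_mx m n (a : 'I_d) (A : V -> 'M[R]_(m, n)) (x : V) :
    'M[R]_(m, n) := \matrix_(i, j) partial a (fun y => A y i j) x.

Lemma partial_mulmx m n p a (A : V -> 'M[R]_(m, n)) (B : V -> 'M[R]_(n, p)) x :
  (forall i j, smooth (fun y => A y i j)) ->
  (forall i j, smooth (fun y => B y i j)) ->
  partial_mx a (fun y => A y *m B y) x =
    partial_mx a A x *m B x + A x *m partial_mx a B x.
Proof.
move=> sA sB; apply/matrixP => i j; rewrite !mxE.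
under eq_fun do rewrite mxE.
rewrite partial_sum => [|k]; last exact: smoothM.
rewrite -big_split; apply: eq_bigr => k _ /=; rewrite !mxE.
rewrite partialM; [|exact: smooth_derivable|exact: smooth_derivable].
by rewrite [LHS]addrC [X in X + _ = _]mulrC.
Qed.

Lemma metric_smooth_euclidean (g : metric M) i a b : smooth (fun x => g i x a b).
Proof. exact: metric_smooth g i a b. Qed.

Lemma conformally_equivalent_refl (g : metric M) : conformally_equivalent g g.
Proof.
exists (fun=> 1); split=> //; first exact/smooth_fun_euclidean/smooth_cst.
by move=> i x _; rewrite scale1r.
Qed.

Lemma conformally_equivalent_sym (g h : metric M) :
  conformally_equivalent g h -> conformally_equivalent h g.
Proof.
case=> f [/smooth_fun_euclidean sf f0 E]; exists (fun x => (f x)^-1); split.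
- by apply/smooth_fun_euclidean/smoothV => // x; rewrite gt_eqF.
- by move=> p; rewrite invr_gt0.
- by move=> i x h1; rewrite E //= scalerA mulVf ?scale1r // gt_eqF.
Qed.

Lemma conformally_equivalent_trans (g h k : metric M) :
  conformally_equivalent g h -> conformally_equivalent h k ->
  conformally_equivalent g k.
Proof.
case=> f [/smooth_fun_euclidean sf f0 E] [f' [/smooth_fun_euclidean sf' f'0 E']].
exists (fun x => f' x * f x); split.
- exact/smooth_fun_euclidean/smoothM.
- by move=> p; rewrite mulr_gt0.
- by move=> i x h1; rewrite E' // E // scalerA.
Qed.

Lemma conformal_class_of_proof (g0 g h : metric M) :
  conformally_equivalent g0 g ->
  conformally_equivalent g0 h <-> conformally_equivalent g h.
Proof.
move=> H; split; last exact: conformally_equivalent_trans.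
exact/conformally_equivalent_trans/conformally_equivalent_sym.
Qed.

Definition conformal_class_of (g0 : metric M) : conformal_class M :=
  @ConformalClass R d M (conformally_equivalent g0)
    (ex_intro _ g0 (conformally_equivalent_refl g0))
    (@conformal_class_of_proof g0).

Lemma cov_metric_conformal (D : connection M) (g h : metric M) (f : V -> R) i x a :
  smooth f -> (forall y, h i y = f y *: g i y) ->
  cov_metric D h i x a = partial a f x *: g i x + f x *: cov_metric D g i x a.
Proof.
move=> sf E; rewrite /cov_metric E -scalemxAr -scalemxAl !scalerBr.
rewrite !addrA; congr (_ - _ - _).
apply/matrixP => b c; rewrite !mxE.
under eq_fun do rewrite E mxE.
rewrite partialM; first by rewrite [LHS]addrC [X in X + _ = _]mulrC.
  exact: smooth_derivable.
by apply: smooth_derivable; exact: metric_smooth_euclidean.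
Qed.

End Euclidean.

(** * Comparing connections which preserve a conformal class *)
Section Pointwise.
Variables (R : realType) (d : nat) (M : manifold R d).
Variables (D D' : connection M) (g : metric M) (J : almost_complex M).
Variables (i : mfd_index M) (x : 'rV[R]_d).
Hypothesis ix : cimg i x.
Local Notation V := 'rV[R]_d.
Local Notation "<< X , Y >>" := (inner (g i x) X Y).
Implicit Types X Y Z : V.

(** g(S_X Y, Z), where S = D' - D. *)
Definition difference X Y Z : R :=
  \sum_a X 0 a * (Y *m (D' i x a - D i x a) *m g i x *m Z^T) 0 0.

Lemma difference_sym X Y Z : torsion_free D -> torsion_free D' ->
  difference X Y Z = difference Y X Z.
Proof.
move=> tD tD'; rewrite /difference.
have E (U W : V) : \sum_a U 0 a * (W *m (D' i x a - D i x a) *m g i x *m Z^T) 0 0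
    = \sum_a \sum_b U 0 a * W 0 b *
        ((D' i x a - D i x a) *m (g i x *m Z^T)) b 0.
  apply: eq_bigr => a _; rewrite -!mulmxA mxE mulr_sumr.
  by apply: eq_bigr => b _; rewrite mulrA.
rewrite !E exchange_big; apply: eq_bigr => a _; apply: eq_bigr => b _.
rewrite [_ * X 0 b]mulrC; congr (_ * _); rewrite !mxE; apply: eq_bigr => c _.
by rewrite !mxE (tD _ _ a b) // (tD' _ _ a b).
Qed.

Lemma difference_metric X Y Z (phi : 'cV[R]_d) :
  (forall a, cov_metric D g i x a - cov_metric D' g i x a = phi a 0 *: g i x) ->
  difference X Y Z + difference X Z Y = (X *m phi) 0 0 * <<Y, Z>>.
Proof.
move=> E; rewrite /difference -big_split mxE mulr_suml; apply: eq_bigr => a _ /=.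
rewrite -mulrDr -mulrA; congr (_ * _).
set S := D' i x a - D i x a.
have Ea : S *m g i x + g i x *m S^T = phi a 0 *: g i x.
  rewrite -E /cov_metric /S linearB /= mulmxBl mulmxBr.
  by apply/matrixP => b c; rewrite !mxE; ring.
have -> : (Z *m S *m g i x *m Y^T) 0 0 = (Y *m (g i x *m S^T) *m Z^T) 0 0.
  have -> : Z *m S *m g i x *m Y^T = (Y *m (g i x *m S^T) *m Z^T)^T.
    by rewrite !trmx_mul !trmxK (Defs.metric_sym g ix) !mulmxA.
  by rewrite mxE.
rewrite -(mulmxA Y S) -[RHS]mulr1.
have -> : (Y *m (S *m g i x) *m Z^T) 0 0 + (Y *m (g i x *m S^T) *m Z^T) 0 0 =
    (Y *m (S *m g i x + g i x *m S^T) *m Z^T) 0 0.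
  by rewrite mulmxDr mulmxDl [RHS]mxE.
by rewrite Ea mulr1 /inner -scalemxAr -scalemxAl mxE.
Qed.

(** A tensor which is symmetric in X and Y, with prescribed symmetric part in Y and
    Z, is determined as in the proof of the Koszul formula. *)
Lemma koszul X Y Z (phi : 'cV[R]_d) : torsion_free D -> torsion_free D' ->
  (forall a, cov_metric D g i x a - cov_metric D' g i x a = phi a 0 *: g i x) ->
  difference X Y Z = 2^-1 * ((X *m phi) 0 0 * <<Y, Z>> + (Y *m phi) 0 0 * <<X, Z>>
    - (Z *m phi) 0 0 * <<X, Y>>).
Proof.
move=> tD tD' E.
have A1 := difference_metric X Y Z E.
have A2 := difference_metric Y Z X E.
have A3 := difference_metric Z X Y E.
rewrite (innerC (Defs.metric_sym g ix) X Z) -A1 -A2 -A3.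
rewrite (difference_sym Y X) // (difference_sym Z X) // (difference_sym Z Y) //.
by field.
Qed.

Hypothesis gJ : J i x *m g i x *m (J i x)^T = g i x.

(** (D'_X J) Y - (D_X J) Y = S_X (JY) - J (S_X Y), and J is skew for g. *)
Lemma DJ_tensor_change (X : 'I_3 -> V) :
  DJ_tensor D' g J i x X = DJ_tensor D g J i x X
    + difference (X 0) (X 1 *m J i x) (X 2) + difference (X 0) (X 1) (X 2 *m J i x).
Proof.
rewrite /DJ_tensor /difference -!big_split; apply: eq_bigr => a _ /=.
rewrite -!mulrDr; congr (_ * _).
have Jg : J i x *m g i x = - (g i x *m (J i x)^T).
  by rewrite -{1}gJ !mulmxA (ac_sqr J ix) !mulNmx mul1mx.
set S := D' i x a - D i x a.
have -> : cov_ac D' J i x a = cov_ac D J i x a + (J i x *m S - S *m J i x).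
  by rewrite /cov_ac /S mulmxBr mulmxBl; apply/matrixP => b c; rewrite !mxE; ring.
clearbody S.
have E : X 1 *m (J i x *m S - S *m J i x) *m g i x *m (X 2)^T =
    X 1 *m J i x *m S *m g i x *m (X 2)^T
    + X 1 *m S *m g i x *m (X 2 *m J i x)^T.
  rewrite trmx_mul mulmxBr !mulmxBl !mulmxA; congr (_ + _).
  by rewrite -(mulmxA _ (J i x) (g i x)) Jg mulmxN mulNmx opprK !mulmxA.
by rewrite mulmxDr !mulmxDl E [LHS]mxE [X in _ + X = _]mxE addrA.
Qed.

(** Two Weyl connections differ by the 1-form phi / 2, and the terms in phi(X) of
    the Koszul formula cancel because J is skew. *)
Lemma DJ_tensor_weyl (X : 'I_3 -> V) (phi : 'cV[R]_d) :
  torsion_free D -> torsion_free D' ->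
  (forall a, cov_metric D g i x a - cov_metric D' g i x a = phi a 0 *: g i x) ->
  DJ_tensor D' g J i x X = DJ_tensor D g J i x X +
    weyl_change (g i x) (J i x) (fun Y => (Y *m (2^-1 *: phi)) 0 0)
      (X 0) (X 1) (X 2).
Proof.
move=> tD tD' E; rewrite DJ_tensor_change !(koszul _ _ _ tD tD' E) -addrA.
have P Y : (Y *m (2^-1 *: phi)) 0 0 = 2^-1 * (Y *m phi) 0 0.
  by rewrite -scalemxAr mxE.
congr (_ + _); rewrite /weyl_change !P.
have J2 := ac_sqr J ix; have gT := Defs.metric_sym g ix.
by rewrite !(innerJl J2 gJ); field.
Qed.

End Pointwise.

(** The Levi-Civita connection annihilates g, and the g-symmetric part of the
    endomorphism Y |-> eta(X) Y + eta(Y) X - g(X, Y) eta^# is eta(X) id. *)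
Lemma lee_form_cov_metric (R : realType) (d : nat) (M : manifold R d)
    (D : connection M) (g : metric M) (eta : one_form M) :
  lee_form D g eta ->
  forall i x a, cimg i x -> cov_metric D g i x a = (-2 * eta i x a 0) *: g i x.
Proof.
case=> nabla [_ gn] E i x a ix.
have gT := Defs.metric_sym g ix.
have gU : g i x \in unitmx.
  rewrite -row_free_unit -kermx_eq0; apply/eqP/row_matrixP => k; rewrite row0.
  apply/eqP/negPn/negP => /(@Defs.metric_pos _ _ _ g _ _ _ ix); set X := row k _.
  by rewrite /X -row_mul mulmx_ker row0 mul0mx mxE ltxx.
set S := D i x a - nabla i x a.
have Sg : S *m g i x = eta i x a 0 *: g i x + eta i x *m row a (g i x)
    - (row a (g i x))^T *m (eta i x)^T.
  apply/row_matrixP => b; rewrite row_mul.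
  have := E i x (delta_mx 0 a) (delta_mx 0 b) ix.
  rewrite (bigD1 a) //= big1 => [|c ca]; last first.
    by rewrite mxE (negbTE ca) andbF scale0r.
  rewrite mxE !eqxx scale1r addr0 -!rowE -/S => ->.
  have -> : row a (eta i x) 0 0 = eta i x a 0 by rewrite mxE.
  have -> : row b (eta i x) 0 0 = eta i x b 0 by rewrite mxE.
  have -> : (row a (g i x) *m (delta_mx 0 b : 'rV[R]_d)^T) 0 0 = g i x a b.
    by rewrite trmx_delta -colE !mxE.
  rewrite mulmxBl mulmxDl -!scalemxAl -!rowE -mulmxA mulVmx // mulmx1.
  rewrite !linearB !linearD /=; congr (_ + _ - _).
  - by apply/rowP => c; rewrite !mxE.
  - by apply/rowP => c; rewrite !mxE big_ord1 !mxE.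
  - by apply/rowP => c; rewrite !mxE big_ord1 !mxE.
have -> : cov_metric D g i x a = cov_metric nabla g i x a
    - (S *m g i x + (S *m g i x)^T).
  rewrite trmx_mul gT /cov_metric /S linearB /= mulmxBl mulmxBr.
  by apply/matrixP => b c; rewrite !mxE; ring.
have gsym b c : g i x b c = g i x c b by rewrite -{1}gT mxE.
rewrite gn // Sg; apply/matrixP => b c; rewrite !mxE !big_ord1 !mxE (gsym c b).
by ring.
Qed.

(** * Structure constants of the nilpotent Lie group *)
Section StructureConstants.

(** de^k = 2 sum_(i, j) (str_const k i j) e^i /\ e^j, where the
    indices start from 0, so that k = 4 is the index of e^5.  The factor 2 makes
    all the coefficients of the connection integers. *)
Definition str_const (k i j : nat) : int :=
  match k, i, j with
  | 4%N, 0%N, 2%N => 1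
  | 4%N, 1%N, 3%N | 5%N, 0%N, 1%N | 5%N, 2%N, 3%N
  | 5%N, 0%N, 3%N | 5%N, 1%N, 2%N => -1
  | _, _, _ => 0
  end.

(** Half of the value of de^k on (e_i, e_j), which is minus half of the
    component of [e_i, e_j] along e_k. *)
Definition lie_const (k i j : nat) : int := str_const k i j - str_const k j i.

(** The components of - e^5. *)
Definition lee_const (i : nat) : int := - (i == 4%N)%:R.

(** The component along e_k of D_(e_i) e_j: the first line is the Koszul formula
    for the Levi-Civita connection in an orthonormal left-invariant frame, the
    second one is the change by the 1-form lee_const. *)
Definition conn_const (i j k : nat) : int :=
  - lie_const k i j + lie_const i j k - lie_const j k i
  + lee_const i * (j == k)%:R + lee_const j * (i == k)%:R - (i == j)%:R * lee_const k.

Definition J_const (i j : nat) : int :=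
  match i, j with
  | 0%N, 1%N | 2%N, 3%N | 4%N, 5%N => 1
  | 1%N, 0%N | 3%N, 2%N | 5%N, 4%N => -1
  | _, _ => 0
  end.

(** Unlike the big operator, this sum can be evaluated. *)
Definition sum6 (F : nat -> int) : int :=
  F 0%N + F 1%N + F 2%N + F 3%N + F 4%N + F 5%N.

Lemma sum6E (F : nat -> int) : \sum_(i < 6) F i = sum6 F.
Proof. by rewrite !big_ord_recl big_ord0 /sum6 addr0 !addrA. Qed.

Lemma all6 (P : pred nat) : all P (iota 0 6) -> forall i : 'I_6, P i.
Proof. by move=> /allP H i; apply: H; rewrite mem_iota ltn_ord. Qed.

Lemma all6_2 (P : nat -> pred nat) :
  all (fun i => all (P i) (iota 0 6)) (iota 0 6) -> forall i j : 'I_6, P i j.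
Proof. by move=> H i j; exact: all6 (all6 (P := fun i => all (P i) _) H i) j. Qed.

Lemma all6_3 (P : nat -> nat -> pred nat) :
  all (fun i => all (fun j => all (P i j) (iota 0 6)) (iota 0 6)) (iota 0 6) ->
  forall i j k : 'I_6, P i j k.
Proof.
move=> H i; apply: all6_2.
exact: (all6 (P := fun i => all (fun j => all (P i j) _) _) H i).
Qed.

(** The component along e_k of (D_(e_i) J) e_j. *)
Definition nabJ_const (i j k : nat) : int :=
  sum6 (fun l => J_const j l * conn_const i l k)
  - sum6 (fun l => conn_const i j l * J_const l k).

Lemma J_const_sqr (i j : 'I_6) :
  \sum_(l < 6) J_const i l * J_const l j = - (i == j)%:R.
Proof.
rewrite (sum6E (fun l => J_const i l * J_const l j)) -val_eqE; apply/eqP; move: i j.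
apply: (all6_2 (P := fun i j =>
  sum6 (fun l => J_const i l * J_const l j) == - (i == j)%:R)).
by vm_compute.
Qed.

Lemma J_const_anti (i j : 'I_6) : J_const j i = - J_const i j.
Proof.
apply/eqP; move: i j.
by apply: (all6_2 (P := fun i j => J_const j i == - J_const i j)); vm_compute.
Qed.

(** The values k = 4, 5 index the centre, while i and j range over 0, ..., 3 in the
    nonzero constants str_const k i j. *)
Lemma str_const_two_step (a b c k i : 'I_6) :
  str_const c a b * str_const k c i = 0 /\
  str_const c a b * str_const k i c = 0.
Proof.
pose P (a b c : nat) := (4 <= c)%N || (str_const c a b == 0).
pose P' (c k i : nat) :=
  (c < 4)%N || (str_const k c i == 0) && (str_const k i c == 0).
have H : forall a b c : 'I_6, P a b c by apply: all6_3; vm_compute.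
have K : forall c k i : 'I_6, P' c k i by apply: all6_3; vm_compute.
have /orP[c4|/eqP ->] := H a b c; last by rewrite !mul0r.
have := K c k i; rewrite /P' ltnNge c4 /= => /andP[/eqP -> /eqP ->].
by rewrite !mulr0.
Qed.

Lemma conn_const_torsion (i j k : nat) :
  conn_const i j k - conn_const j i k = - 2 * lie_const k i j.
Proof. by rewrite /conn_const /lie_const (eq_sym j i); ring. Qed.

Lemma conn_const_skew (i j k : nat) :
  conn_const i j k + conn_const i k j = 2 * lee_const i * (j == k)%:R.
Proof. by rewrite /conn_const /lie_const (eq_sym k j); ring. Qed.

(** T(J e_i, J e_j, e_k) = - T(e_i, e_j, e_k) for T = g((D J) ., .): the structure
    is of type W1 + W2 + W4 and D is its adapted connection. *)
Lemma nabJ_const_J12 (i j k : 'I_6) :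
  \sum_(l < 6) \sum_(p < 6) J_const i l * J_const j p * nabJ_const l p k =
  - nabJ_const i j k.
Proof.
pose F (i j k l p : nat) := J_const i l * J_const j p * nabJ_const l p k.
under eq_bigr => l _ do rewrite (sum6E (F i j k l)).
rewrite (sum6E (fun l => sum6 (F i j k l))); apply/eqP; move: i j k.
apply: (all6_3 (P := fun i j k =>
  sum6 (fun l => sum6 (F i j k l)) == - nabJ_const i j k)).
by vm_compute.
Qed.

End StructureConstants.

(** * The left-invariant structure on R^6 *)
Section Example.
Variable R : realType.
Local Notation V := 'rV[R]_6.
Local Notation M := (euclidean R 6).
Implicit Types (x X Y Z : V).

(** The partial derivative of the coframe with respect to the a-th coordinate, so
    that de^k (d_a, d_b) = dcoframe a b k - dcoframe b a k. *)
Definition dcoframe (a : 'I_6) : 'M[R]_6 := \matrix_(b, k) (2 * str_const k a b)%:~R.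
Definition lin_part x : 'M[R]_6 := \sum_a x 0 a *: dcoframe a.
(** The (b, k) entry is e^k (d_b), so a tangent vector X has components
    X *m coframe x in the frame e_1, ..., e_6. *)
Definition coframe x : 'M[R]_6 := 1%:M + lin_part x.
(** The inverse of the coframe, since the linear part has square zero. *)
Definition frame x : 'M[R]_6 := 1%:M - lin_part x.
Definition J0 : 'M[R]_6 := \matrix_(i, j) (J_const i j)%:~R.
Definition conn_mx (i : 'I_6) : 'M[R]_6 := \matrix_(j, k) (conn_const i j k)%:~R.
Definition lie_mx (k : 'I_6) : 'M[R]_6 := \matrix_(i, j) (lie_const k i j)%:~R.
Definition lee_col : 'cV[R]_6 := \col_i (lee_const i)%:~R.
Definition nabJ (i : 'I_6) : 'M[R]_6 := J0 *m conn_mx i - conn_mx i *m J0.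

Lemma dcoframe_dcoframe a b : dcoframe a *m dcoframe b = 0.
Proof.
apply/matrixP => i k; rewrite !mxE big1 // => c _; rewrite !mxE -intrM.
have [_ E] := str_const_two_step a i c k b.
by rewrite mulrACA E mulr0.
Qed.

Lemma lin_dcoframe x a : lin_part x *m dcoframe a = 0.
Proof.
rewrite /lin_part mulmx_suml big1 // => b _.
by rewrite -scalemxAl dcoframe_dcoframe scaler0.
Qed.

Lemma dcoframe_lin x a : dcoframe a *m lin_part x = 0.
Proof.
rewrite /lin_part mulmx_sumr big1 // => b _.
by rewrite -scalemxAr dcoframe_dcoframe scaler0.
Qed.

Lemma lin_lin x y : lin_part x *m lin_part y = 0.
Proof.
rewrite /lin_part mulmx_suml big1 // => b _.
by rewrite -scalemxAl dcoframe_lin scaler0.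
Qed.

Lemma lin_lie x k : lin_part x *m lie_mx k = 0.
Proof.
rewrite /lin_part mulmx_suml big1 // => a _; rewrite -scalemxAl.
rewrite (_ : dcoframe a *m lie_mx k = 0) ?scaler0 //.
apply/matrixP => b i; rewrite !mxE big1 // => c _; rewrite !mxE -intrM /lie_const.
have [E1 E2] := str_const_two_step a b c k i.
by rewrite mulrBr -!mulrA E1 E2 !mulr0 subrr.
Qed.

Lemma coframeK x : coframe x *m frame x = 1%:M.
Proof.
rewrite /coframe /frame mulmxBr mulmx1 mulmxDl mul1mx lin_lin addr0.
by rewrite addrK.
Qed.

Lemma frameK x : frame x *m coframe x = 1%:M.
Proof. exact/mulmx1C/coframeK. Qed.

Lemma frame_dcoframe x a : frame x *m dcoframe a = dcoframe a.
Proof. by rewrite /frame mulmxBl mul1mx lin_dcoframe subr0. Qed.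

Lemma dcoframe_frame x a : dcoframe a *m frame x = dcoframe a.
Proof. by rewrite /frame mulmxBr mulmx1 dcoframe_lin subr0. Qed.

Lemma J0_sqr : J0 *m J0 = - 1%:M.
Proof.
apply/matrixP => i j; rewrite !mxE.
under eq_bigr => l _ do rewrite !mxE -intrM.
by rewrite -(rmorph_sum intr) J_const_sqr rmorphN /= rmorph_nat.
Qed.

Lemma J0_tr : J0^T = - J0.
Proof. by apply/matrixP => i j; rewrite !mxE J_const_anti rmorphN. Qed.

Lemma conn_mx_skew i : conn_mx i + (conn_mx i)^T = (2 * lee_const i)%:~R%:M.
Proof.
apply/matrixP => j k; rewrite !mxE -intrD conn_const_skew intrM rmorph_nat.
by rewrite mulr_natr.
Qed.

Lemma nabJ_skew i : (nabJ i)^T = - nabJ i.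
Proof.
have -> : nabJ i = J0 *m conn_mx i - conn_mx i *m J0 by [].
have GT : (conn_mx i)^T = (2 * lee_const i)%:~R%:M - conn_mx i.
  by rewrite -conn_mx_skew addrC addKr.
rewrite linearB /= !trmx_mul J0_tr GT mulmxN mulNmx opprK mulmxBl mulmxBr.
rewrite scalar_mxC.
by rewrite !opprB addrA subrK.
Qed.

Lemma nabJ_J i : J0 *m nabJ i = - (nabJ i *m J0).
Proof.
rewrite /nabJ mulmxBr mulmxBl !mulmxA J0_sqr -(mulmxA _ J0 J0) J0_sqr.
by rewrite mulNmx mul1mx mulmxN mulmx1 opprK opprD addrC.
Qed.

Lemma nabJ_J12 i : \sum_l J0 i l *: (J0 *m nabJ l) = - nabJ i.
Proof.
have nE l p k : nabJ l p k = (nabJ_const l p k)%:~R.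
  rewrite !mxE /nabJ_const rmorphB /= -!sum6E !rmorph_sum /=.
  by congr (_ - _); apply: eq_bigr => q _; rewrite !mxE rmorphM.
apply/matrixP => j k; rewrite [RHS]mxE nE -rmorphN -nabJ_const_J12 rmorph_sum summxE.
apply: eq_bigr => l _; rewrite !mxE rmorph_sum mulr_sumr.
by apply: eq_bigr => p _; rewrite nE !mxE !rmorphM /= mulrA.
Qed.

Definition metric_mx x : 'M[R]_6 := coframe x *m (coframe x)^T.
Definition acs_mx x : 'M[R]_6 := coframe x *m J0 *m frame x.
(** The matrix in the frame of Y |-> D_(d_a) Y, for left-invariant Y. *)
Definition conn_along x (a : 'I_6) : 'M[R]_6 := \sum_i coframe x a i *: conn_mx i.
(** The change of the connection matrix from the frame to the coordinate fields,
    d_b being the combination of the e_k with coefficients e^k (d_b). *)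
Definition christoffel x (a : 'I_6) : 'M[R]_6 :=
  (dcoframe a + coframe x *m conn_along x a) *m frame x.

Lemma smooth_lin_part a b : smooth (fun x => lin_part x a b).
Proof.
under eq_fun do rewrite summxE; apply: smooth_sum => c.
under eq_fun do rewrite mxE.
by apply: smoothM; [exact: smooth_coord | exact: smooth_cst].
Qed.

Lemma smooth_coframe a b : smooth (fun x => coframe x a b).
Proof.
under eq_fun do rewrite mxE.
by apply: smoothD; [exact: smooth_cst | exact: smooth_lin_part].
Qed.

Lemma smooth_frame a b : smooth (fun x => frame x a b).
Proof.
under eq_fun do rewrite !mxE -mulN1r.
apply: smoothD; first exact: smooth_cst.
by apply: smoothM; [exact: smooth_cst | exact: smooth_lin_part].
Qed.

Lemma smooth_metric_mx a b : smooth (fun x => metric_mx x a b).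
Proof.
apply: smooth_mulmx => i j; first exact: smooth_coframe.
by under eq_fun do rewrite mxE; exact: smooth_coframe.
Qed.

Lemma smooth_acs_mx a b : smooth (fun x => acs_mx x a b).
Proof.
apply: smooth_mulmx => [{}a {}b|]; last exact: smooth_frame.
by apply: smooth_mulmx; [exact: smooth_coframe | move=> i j; exact: smooth_cst].
Qed.

Lemma smooth_christoffel a b c : smooth (fun x => christoffel x a b c).
Proof.
apply: smooth_mulmx => [{}b {}c|]; last exact: smooth_frame.
under eq_fun do rewrite mxE; apply: smoothD; first exact: smooth_cst.
apply: smooth_mulmx => [|{}b {}c]; first exact: smooth_coframe.
under eq_fun do rewrite summxE; apply: smooth_sum => i.
under eq_fun do rewrite mxE.
by apply: smoothM; [exact: smooth_coframe | exact: smooth_cst].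
Qed.

Lemma partial_lin_part a x : partial_mx a lin_part x = dcoframe a.
Proof.
apply/matrixP => b k; rewrite mxE.
under eq_fun do rewrite summxE.
rewrite partial_sum => [|c]; last first.
  under eq_fun do rewrite mxE.
  by apply: smoothM; [exact: smooth_coord | exact: smooth_cst].
rewrite (bigD1 a) //= big1 ?addr0 => [|c ca];
  under eq_fun do rewrite mxE;
  rewrite partialM ?partial_coord ?partial_cst;
  try solve [exact: smooth_derivable (smooth_coord _ _) |
             by apply: smooth_derivable; exact: smooth_cst |
             by apply: smooth_derivable; exact: smooth_coord].
  by rewrite eqxx mulr1 mulr0 add0r.
by rewrite eq_sym (negbTE ca) !mulr0 addr0.
Qed.

Lemma partial_coframe a x : partial_mx a coframe x = dcoframe a.
Proof.
rewrite -(partial_lin_part a x); apply/matrixP => b k; rewrite !mxE.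
under eq_fun do rewrite mxE.
rewrite partialD; first by rewrite partial_cst add0r.
  by apply: smooth_derivable; exact: smooth_cst.
by apply: smooth_derivable; exact: smooth_lin_part.
Qed.

Lemma partial_frame a x : partial_mx a frame x = - dcoframe a.
Proof.
rewrite -(partial_lin_part a x); apply/matrixP => b k; rewrite !mxE.
under eq_fun do rewrite !mxE.
rewrite partialB; first by rewrite partial_cst sub0r.
  by apply: smooth_derivable; exact: smooth_cst.
by apply: smooth_derivable; exact: smooth_lin_part.
Qed.

Lemma metric_mx_sym x : (metric_mx x)^T = metric_mx x.
Proof. by rewrite /metric_mx trmx_mul trmxK. Qed.

Lemma metric_mx_pos x X : X != 0 -> 0 < (X *m metric_mx x *m X^T) 0 0.
Proof.
move=> X0; have Y0 : X *m coframe x != 0.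
  apply: contraNneq X0 => E; rewrite -[X]mulmx1 -(coframeK x) mulmxA E.
  by rewrite mul0mx.
have -> : X *m metric_mx x *m X^T = (X *m coframe x) *m (X *m coframe x)^T.
  by rewrite /metric_mx trmx_mul !mulmxA.
move: (X *m _) Y0 => Y Y0; rewrite mxE lt_def sumr_ge0 => [|i _]; last first.
  by rewrite mxE -expr2 sqr_ge0.
rewrite andbT; apply: contraNneq Y0 => /eqP; rewrite psumr_eq0 => [/allP H|i _].
  apply/eqP/rowP => i; have := H i (mem_index_enum _).
  by rewrite !mxE mulf_eq0 orbb => /eqP.
by rewrite mxE -expr2 sqr_ge0.
Qed.

Lemma acs_mx_sqr x : acs_mx x *m acs_mx x = - 1%:M.
Proof.
rewrite /acs_mx !mulmxA -(mulmxA _ (frame x)) frameK mulmx1 -(mulmxA _ J0 J0) J0_sqr.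
by rewrite mulmxN mulmx1 mulNmx coframeK.
Qed.

Lemma acs_mx_orth x : acs_mx x *m metric_mx x *m (acs_mx x)^T = metric_mx x.
Proof.
have E : acs_mx x *m coframe x = coframe x *m J0.
  by rewrite /acs_mx -mulmxA frameK mulmx1.
have -> : acs_mx x *m metric_mx x *m (acs_mx x)^T =
    (acs_mx x *m coframe x) *m (acs_mx x *m coframe x)^T.
  by rewrite /metric_mx (trmx_mul (acs_mx x) (coframe x)) !mulmxA.
rewrite E trmx_mul J0_tr mulNmx mulmxN !mulmxA -(mulmxA _ J0 J0) J0_sqr.
by rewrite mulmxN mulmx1 mulNmx opprK.
Qed.

Definition left_metric : metric M :=
  euclidean_metric smooth_metric_mx metric_mx_sym metric_mx_pos.
Definition left_acs : almost_complex M :=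
  euclidean_ac smooth_acs_mx acs_mx_sqr.
Definition adapted_connection : connection M :=
  euclidean_connection smooth_christoffel.
Local Notation g0 := left_metric.
Local Notation J := left_acs.
Local Notation D := adapted_connection.

(** In the frame the torsion is de^k (d_a, d_b) plus the antisymmetrized connection
    coefficients, pulled back by the coframe.  These are minus the components of
    de^k in the frame, and the pull-back fixes their matrix because de^k vanishes
    on the centre. *)
Lemma adapted_torsion_free : torsion_free D.
Proof.
move=> i x a b c _; rewrite /adapted_connection /= /christoffel !mxE.
apply: eq_bigr => k _.
congr (_ * _); rewrite !mxE.
have E (u v : 'I_6) : \sum_j coframe x v j * conn_along x u j k =
    (coframe x *m (\matrix_(i, j) (conn_const i j k)%:~R) *m (coframe x)^T) u v.
  rewrite mxE; apply: eq_bigr => j _; rewrite [RHS]mulrC [_^T _ _]mxE; congr (_ * _).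
  by rewrite summxE mxE; apply: eq_bigr => l _; rewrite !mxE.
have QL : coframe x *m lie_mx k *m (coframe x)^T = lie_mx k.
  have LT : (lie_mx k)^T = - lie_mx k.
    by apply/matrixP => u v; rewrite !mxE /lie_const -rmorphN opprB.
  have Q1 : coframe x *m lie_mx k = lie_mx k.
    by rewrite /coframe mulmxDl mul1mx lin_lie addr0.
  apply: trmx_inj; rewrite Q1 trmx_mul trmxK LT mulmxN.
  by rewrite Q1.
set G := \matrix_(i, j) _ in E.
have GT : G - G^T = -2 *: lie_mx k.
  apply/matrixP => u v; rewrite !mxE -rmorphB /= conn_const_torsion rmorphM /=.
  by rewrite rmorphN.
have F : (coframe x *m (G - G^T) *m (coframe x)^T) a b = -2 * (lie_const k a b)%:~R.
  by rewrite GT -scalemxAr -scalemxAl QL !mxE.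
have : (coframe x *m G *m (coframe x)^T) a b - (coframe x *m G *m (coframe x)^T) b a
    = -2 * (lie_const k a b)%:~R.
  rewrite -F mulmxBr mulmxBl [RHS]mxE [X in _ = _ + X]mxE; congr (_ - _).
  have -> : coframe x *m G^T *m (coframe x)^T = (coframe x *m G *m (coframe x)^T)^T.
    by rewrite !trmx_mul trmxK mulmxA.
  by rewrite [RHS]mxE.
rewrite -!E /lie_const !rmorphM rmorphB /= => H.
by move: H; set s1 := \sum_j _; set s2 := \sum_j _ => H; lra.
Qed.

(** The 1-form 2 e^5, with D g0 = theta0 (x) g0. *)
Definition theta0 x : 'cV[R]_6 := -2 *: (coframe x *m lee_col).

Lemma conn_along_skew x a :
  conn_along x a + (conn_along x a)^T = (- theta0 x a 0)%:M.
Proof.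
rewrite /conn_along linear_sum -big_split /=.
under eq_bigr => i _ do rewrite linearZ /= -scalerDr conn_mx_skew scale_scalar_mx.
rewrite -(raddf_sum (@scalar_mx R 6)) /=; congr (_%:M).
rewrite !mxE mulNr opprK mulr_sumr; apply: eq_bigr => i _.
by rewrite !mxE rmorphM /= mulrCA.
Qed.

Lemma cov_metric_left_metric i x a : cov_metric D g0 i x a = theta0 x a 0 *: g0 i x.
Proof.
have -> : cov_metric D g0 i x a =
    partial_mx a metric_mx x - christoffel x a *m metric_mx x
    - (christoffel x a *m metric_mx x)^T.
  by rewrite trmx_mul metric_mx_sym.
have -> : partial_mx a metric_mx x =
    dcoframe a *m (coframe x)^T + coframe x *m (dcoframe a)^T.
  have sT i' j : smooth (fun y => (coframe y)^T i' j).
    by under eq_fun do rewrite mxE; exact: smooth_coframe.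
  rewrite [LHS](partial_mulmx a x smooth_coframe sT) partial_coframe.
  congr (_ + _ *m _); rewrite -(partial_coframe a x).
  by apply/matrixP => b c; rewrite !mxE; under eq_fun do rewrite mxE.
have -> : christoffel x a *m metric_mx x =
    (dcoframe a + coframe x *m conn_along x a) *m (coframe x)^T.
  by rewrite /christoffel /metric_mx mulmxA -(mulmxA _ (frame x)) frameK mulmx1.
have trD : (dcoframe a + coframe x *m conn_along x a)^T =
    (dcoframe a)^T + (conn_along x a)^T *m (coframe x)^T.
  by rewrite linearD /= trmx_mul.
rewrite (trmx_mul _ (coframe x)^T) trmxK trD.
rewrite (mulmxDl (dcoframe a)) (mulmxDr (coframe x)).
have -> : theta0 x a 0 *: g0 i x =
    - (coframe x *m (conn_along x a + (conn_along x a)^T) *m (coframe x)^T).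
  rewrite conn_along_skew raddfN /= mulmxN mulNmx opprK mul_mx_scalar -scalemxAl.
  by [].
rewrite (mulmxDr (coframe x)) (mulmxDl (coframe x *m _)) !mulmxA.
move: (dcoframe a *m (coframe x)^T) (coframe x *m (dcoframe a)^T) => A B.
move: (coframe x *m conn_along x a *m (coframe x)^T) => P.
move: (coframe x *m (conn_along x a)^T *m (coframe x)^T) => P'.
by apply/matrixP => b c; rewrite !mxE; ring.
Qed.

(** As J has constant components in the frame, only the commutator of J0 with the
    connection matrix remains. *)
Lemma cov_ac_left_acs i x a :
  cov_ac D J i x a = coframe x *m (\sum_l coframe x a l *: nabJ l) *m frame x.
Proof.
have -> : cov_ac D J i x a = partial_mx a acs_mx x
    + acs_mx x *m christoffel x a - christoffel x a *m acs_mx x.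
  by [].
have -> : partial_mx a acs_mx x =
    dcoframe a *m J0 *m frame x - coframe x *m J0 *m dcoframe a.
  rewrite /acs_mx partial_mulmx; first last.
  - exact: smooth_frame.
  - by apply: smooth_mulmx; [exact: smooth_coframe | move=> u v; exact: smooth_cst].
  rewrite partial_frame mulmxN; congr (_ *m _ - _).
  rewrite partial_mulmx; first last.
  - by move=> u v; exact: smooth_cst.
  - exact: smooth_coframe.
  rewrite partial_coframe -[RHS]addr0; congr (_ + _).
  rewrite (_ : partial_mx a (fun=> J0) x = 0) ?mulmx0 //.
  by apply/matrixP => u v; rewrite !mxE partial_cst.
have -> : acs_mx x *m christoffel x a = coframe x *m J0 *m dcoframe a
    + coframe x *m J0 *m conn_along x a *m frame x.
  rewrite /christoffel (mulmxDl (dcoframe a)) dcoframe_frame (mulmxDr (acs_mx x)).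
  rewrite /acs_mx; congr (_ + _).
    by rewrite -mulmxA frame_dcoframe.
  by rewrite !mulmxA -(mulmxA _ (frame x) (coframe x)) frameK mulmx1.
have -> : christoffel x a *m acs_mx x = dcoframe a *m J0 *m frame x
    + coframe x *m conn_along x a *m J0 *m frame x.
  rewrite /acs_mx /christoffel !mulmxA -(mulmxA _ (frame x) (coframe x)).
  by rewrite frameK mulmx1 (mulmxDl (dcoframe a)) (mulmxDl (dcoframe a *m J0)).
have -> : \sum_l coframe x a l *: nabJ l =
    J0 *m conn_along x a - conn_along x a *m J0.
  rewrite /conn_along mulmx_sumr mulmx_suml -sumrB; apply: eq_bigr => l _.
  by rewrite -scalemxAr -scalemxAl -scalerBr.
rewrite (mulmxBr (coframe x)) (mulmxBl (coframe x *m _)) !mulmxA.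
move: (dcoframe a *m J0 *m frame x) (coframe x *m J0 *m dcoframe a) => A B.
move: (coframe x *m J0 *m conn_along x a *m frame x) => P.
move: (coframe x *m conn_along x a *m J0 *m frame x) => P'.
by apply/matrixP => u v; rewrite !mxE; ring.
Qed.

End Example.

(** * The conformal almost Hermitian manifold *)
Section ConformalStructure.
Variable R : realType.
Local Notation V := 'rV[R]_6.
Local Notation M := (euclidean R 6).
Local Notation D := (adapted_connection R).
Local Notation J := (left_acs R).
Local Notation g0 := (left_metric R).
Local Notation c := (conformal_class_of g0).
Implicit Types (x X Y Z : V).

Lemma left_acs_orthogonal : orthogonal_ac c J.
Proof.
move=> g [f [_ _ E]] i x ix; rewrite E // -scalemxAr -scalemxAl.
by congr (_ *: _); exact: acs_mx_orth.
Qed.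

Definition example : conformal_almost_hermitian R 6 :=
  @ConformalAlmostHermitian R 6 M c J left_acs_orthogonal.

(** d (ln f) + theta0, with D (f g0) = conformal_theta f (x) f g0. *)
Definition conformal_theta (f : V -> R) x : 'cV[R]_6 :=
  \col_a (partial a f x * (f x)^-1 + theta0 x a 0).

Lemma smooth_theta0 a : smooth (fun x => theta0 x a 0 : R).
Proof.
under eq_fun do rewrite mxE; apply: smoothM; first exact: smooth_cst.
by apply: smooth_mulmx => [|i j]; [exact: smooth_coframe | exact: smooth_cst].
Qed.

Lemma smooth_conformal_theta f : smooth f -> (forall x, 0 < f x) ->
  forall a, smooth (fun x => conformal_theta f x a 0).
Proof.
move=> sf f0 a; under eq_fun do rewrite mxE.
apply: smoothD (smooth_theta0 a); apply: smoothM; first exact: smooth_partial.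
by apply: smoothV => // x; rewrite gt_eqF.
Qed.

Lemma cov_metric_theta (g : metric M) f : smooth f -> (forall x, 0 < f x) ->
  (forall i x, g i x = f x *: g0 i x) ->
  forall i x a, cov_metric D g i x a = conformal_theta f x a 0 *: g i x.
Proof.
move=> sf f0 E i x a.
rewrite (cov_metric_conformal D x a sf (E i)) cov_metric_left_metric E.
rewrite [conformal_theta _ _ _ _]mxE.
rewrite !scalerA -scalerDl; congr (_ *: _).
by rewrite mulrDl divfK ?gt_eqF // [f x * _]mulrC.
Qed.

Lemma adapted_weyl : weyl c D.
Proof.
split; first exact: adapted_torsion_free.
move=> g [f [/smooth_fun_euclidean sf f0 E]].
exists (euclidean_form (smooth_conformal_theta sf f0)) => i x a _.
by apply: cov_metric_theta => // {}i {}x; apply: E.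
Qed.

(** g0((D_U J) W, T), where the arguments are given by their components in the
    frame. *)
Definition frame_nabJ (U W T : V) : R :=
  \sum_i U 0 i * (W *m nabJ R i *m T^T) 0 0.

Definition nabJ_tensor x (r : R) X Y Z : R :=
  r * frame_nabJ (X *m coframe x) (Y *m coframe x) (Z *m coframe x).

Lemma sandwichZ (r : R) (W : V) (B : 'M[R]_6) (T : 'cV[R]_6) :
  (W *m (r *: B) *m T) 0 0 = r * (W *m B *m T) 0 0.
Proof. by rewrite -scalemxAr -scalemxAl mxE. Qed.

Lemma frame_nabJ_J12 U W T :
  frame_nabJ (U *m J0 R) (W *m J0 R) T = - frame_nabJ U W T.
Proof.
have N i : - (U 0 i * (W *m nabJ R i *m T^T) 0 0) =
    U 0 i * (W *m (\sum_l J0 R i l *: (J0 R *m nabJ R l)) *m T^T) 0 0.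
  by rewrite nabJ_J12 mulmxN mulNmx [X in _ = _ * X]mxE mulrN.
rewrite /frame_nabJ -sumrN; under [RHS]eq_bigr => i _ do rewrite N.
under [LHS]eq_bigr => l _ do rewrite [(U *m J0 R) 0 l]mxE mulr_suml.
rewrite exchange_big; apply: eq_bigr => i _.
rewrite mulmx_sumr mulmx_suml summxE mulr_sumr; apply: eq_bigr => l _.
by rewrite sandwichZ !mulmxA mulrA.
Qed.

Lemma is_ambient_frame_nabJ : is_ambient (J0 R) frame_nabJ.
Proof.
split=> [W T r U U'|U T r W W'|U W T|U W T]; rewrite /frame_nabJ.
- rewrite mulr_sumr -big_split; apply: eq_bigr => i _ /=.
  by rewrite !mxE mulrDl mulrA.
- rewrite mulr_sumr -big_split; apply: eq_bigr => i _ /=.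
  have -> : ((r *: W + W') *m nabJ R i *m T^T) 0 0 =
      r * (W *m nabJ R i *m T^T) 0 0 + (W' *m nabJ R i *m T^T) 0 0.
    by rewrite !mulmxDl -!scalemxAl [LHS]mxE [X in X + _ = _]mxE.
  by ring.
- rewrite -sumrN; apply: eq_bigr => i _; rewrite -mulrN; congr (_ * _).
  have -> : W *m nabJ R i *m T^T = - (T *m nabJ R i *m W^T)^T.
    by rewrite !trmx_mul trmxK nabJ_skew mulNmx mulmxN opprK mulmxA.
  by rewrite !mxE.
- apply: eq_bigr => i _; congr (_ * _).
  rewrite trmx_mul J0_tr mulNmx mulmxN !mulmxA -(mulmxA W) nabJ_J.
  by rewrite mulmxN mulNmx !mulmxA.
Qed.

Lemma acs_mx_coframe x X : X *m acs_mx x *m coframe x = X *m coframe x *m J0 R.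
Proof. by rewrite /acs_mx !mulmxA -(mulmxA _ (frame x)) frameK mulmx1. Qed.

Lemma is_ambient_nabJ_tensor x r : is_ambient (acs_mx x) (nabJ_tensor x r).
Proof.
have [l1 l2 alt sJ] := is_ambient_frame_nabJ.
split=> [Y Z s X X'|X Z s Y Y'|X Y Z|X Y Z]; rewrite /nabJ_tensor.
- by rewrite mulmxDl -scalemxAl l1 /=; ring.
- by rewrite mulmxDl -scalemxAl l2 /=; ring.
- by rewrite alt mulrN.
- by rewrite !acs_mx_coframe sJ.
Qed.

Lemma nabJ_tensor_anti x r X Y Z :
  nabJ_tensor x r (X *m acs_mx x) (Y *m acs_mx x) Z = - nabJ_tensor x r X Y Z.
Proof. by rewrite /nabJ_tensor !acs_mx_coframe frame_nabJ_J12 mulrN. Qed.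

Lemma DJ_tensorE (g : metric M) (r : R) i x : g i x = r *: g0 i x ->
  DJ_tensor D g J i x = fun X : 'I_3 -> V => nabJ_tensor x r (X 0) (X 1) (X 2).
Proof.
move=> E; apply/funext => X; rewrite /DJ_tensor /nabJ_tensor /frame_nabJ.
have H a : (X 1 *m cov_ac D J i x a *m g i x *m (X 2)^T) 0 0 =
    r * \sum_l coframe x a l *
      (X 1 *m coframe x *m nabJ R l *m (X 2 *m coframe x)^T) 0 0.
  rewrite cov_ac_left_acs E -scalemxAr -scalemxAl mxE; congr (_ * _).
  have -> : g0 i x = coframe x *m (coframe x)^T by [].
  rewrite !mulmxA -(mulmxA _ (frame x) (coframe x)) frameK mulmx1.
  rewrite mulmx_sumr !mulmx_suml summxE; apply: eq_bigr => l _.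
  by rewrite -scalemxAr -!scalemxAl mxE trmx_mul !mulmxA.
under eq_bigr => a _ do rewrite H mulrCA mulr_sumr.
rewrite -mulr_sumr exchange_big; congr (_ * _); apply: eq_bigr => l _ /=.
rewrite [(X 0 *m coframe x) 0 l]mxE mulr_suml; apply: eq_bigr => a _.
by rewrite mulrA.
Qed.

Lemma example_type : type_W1W2 example.
Proof.
move=> D' [tD' wD'] g cg i x ix.
have [theta' E'] := wD' g cg.
have [f [/smooth_fun_euclidean sf f0 E]] := cg.
have gE i' x' : g i' x' = f x' *: g0 i' x' by exact: E.
have J2 : acs_mx x *m acs_mx x = - 1%:M := acs_mx_sqr x.
have gJ : acs_mx x *m g i x *m (acs_mx x)^T = g i x := left_acs_orthogonal cg ix.
have F : forall a, cov_metric D g i x a - cov_metric D' g i x a =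
    (conformal_theta f x - theta' i x) a 0 *: g i x.
  by move=> a; rewrite (cov_metric_theta sf f0 gE) E' // -scalerBl !mxE.
have -> : DJ_tensor D' g J i x = fun X : 'I_3 -> V =>
    nabJ_tensor x (f x) (X 0) (X 1) (X 2) + weyl_change (g i x) (acs_mx x)
      (fun Y => (Y *m (2^-1 *: (conformal_theta f x - theta' i x))) 0 0)
      (X 0) (X 1) (X 2).
  apply/funext => X.
  rewrite (DJ_tensor_weyl (J := J) ix gJ X (@adapted_torsion_free R) tD' F).
  by rewrite (DJ_tensorE (gE i x)).
have gT : (g i x)^T = g i x := Defs.metric_sym g ix.
have gpos X : X != 0 -> 0 < inner (g i x) X X by exact: (Defs.metric_pos g ix).
exact: (sum3_W1W2W4 J2 (is_ambient_nabJ_tensor x (f x))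
  (nabJ_tensor_anti x (f x)) _ gT gpos gJ).
Qed.

Lemma adapted_connectionP : adapted (M := example) D.
Proof.
split; first exact: adapted_weyl.
move=> g [f [_ _ E]] i x ix; rewrite (DJ_tensorE (E i x ix)).
apply: (sum3_W1W2W3 _ (acs_mx_sqr x)); first exact: is_ambient_nabJ_tensor.
exact: nabJ_tensor_anti.
Qed.

(** Only the component of e^5 contributes: this is the derivative along d_a of the
    coefficient of dx^b in 2 e^5. *)
Lemma partial_theta0 (a b : 'I_6) x : partial a (fun y => theta0 y b 0 : R) x =
  4 * (str_const 4 a b)%:~R.
Proof.
have lee_smooth i j : smooth (fun _ : V => lee_col R i j) by exact: smooth_cst.
have sm := smooth_mulmx (@smooth_coframe R) lee_smooth.
under eq_fun do rewrite mxE.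
rewrite partialM; first last.
- exact: smooth_derivable.
- by apply: smooth_derivable; exact: smooth_cst.
rewrite partial_cst mulr0 addr0.
have := partial_mulmx a x (@smooth_coframe R) lee_smooth.
have -> : partial_mx a (fun=> lee_col R) x = 0.
  by apply/matrixP => u v; rewrite !mxE partial_cst.
rewrite mulmx0 addr0 partial_coframe => /(congr1 (fun B : 'cV[R]_6 => B b 0)).
rewrite mxE => ->; rewrite mxE (bigD1 (4 : 'I_6)) //= big1 => [|k k4].
  by rewrite !mxE rmorphM /= /lee_const /= rmorphN /=; ring.
rewrite !mxE /lee_const (_ : (k == 4 :> nat) = false) ?oppr0 ?mulr0 //.
by apply: negbTE; apply: contra k4 => /eqP e; apply/eqP/val_inj.
Qed.

(** d (ln f) is closed. *)
Lemma partial_log_derivative f a b x : smooth f -> (forall y, 0 < f y) ->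
  partial a (fun y => partial b f y * (f y)^-1) x =
  partial b (fun y => partial a f y * (f y)^-1) x.
Proof.
move=> sf f0; have fn0 y : f y != 0 by rewrite gt_eqF.
have L c e : partial c (fun y => partial e f y * (f y)^-1) x =
    (f x)^-1 * partial c (partial e f) x
    - (f x)^-1 * (f x)^-1 * (partial e f x * partial c f x).
  rewrite partialM; first last.
  - by apply: smooth_derivable; exact: smoothV.
  - by apply: smooth_derivable; exact: smooth_partial.
  rewrite (partialV (smooth_derivable (i := c) sf) fn0).
  by rewrite mulN1r mulrN addrC mulrCA.
by rewrite !L (partial_comm a b sf) (mulrC (partial a f x)).
Qed.

(** de^5 takes the value 2 on the first and third coordinate fields. *)
Lemma example_not_closed : ~ is_closed example.
Proof.
move=> /(_ D adapted_connectionP) [g cg [eta etaL cl]].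
have [f [/smooth_fun_euclidean sf f0 E]] := cg.
have gE i x : g i x = f x *: g0 i x by exact: E.
have etaE x a : eta tt x a 0 = - 2^-1 * conformal_theta f x a 0.
  have := lee_form_cov_metric etaL (i := tt) (x := x) a I.
  rewrite (cov_metric_theta sf f0 gE) => /(congr1 (fun B : 'M[R]_6 => B 0 0)).
  rewrite !mxE => /mulIf H.
  have : g tt x 0 0 != 0.
    have := Defs.metric_pos g (i := tt) (x := x) I (X := delta_mx 0 0).
    have d0 : delta_mx 0 0 != 0 :> V.
      by apply/eqP => /(congr1 (fun X : V => X 0 0)) /eqP; rewrite !mxE oner_eq0.
    by move=> /(_ d0); rewrite -rowE trmx_delta -colE !mxE => /gt_eqF ->.
  by move=> /H ->; field.
(* The coordinates 0 and 2, at the origin. *)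
have := cl tt 0 0 2 I.
have P (a b : 'I_6) : partial a (fun y => eta tt y b 0) 0 = - 2^-1 *
    (partial a (fun y => partial b f y * (f y)^-1) 0 + 4 * (str_const 4 a b)%:~R).
  have sl : smooth (fun x => partial b f x * (f x)^-1).
    apply: smoothM; first exact: smooth_partial.
    by apply: smoothV => // x; rewrite gt_eqF.
  have d1 : derivable_along a (fun _ : V => - 2^-1 : R).
    by apply: smooth_derivable; exact: smooth_cst.
  have d2 := smooth_derivable (i := a) sl.
  have d3 := smooth_derivable (i := a) (smooth_theta0 b).
  have d23 : derivable_along a
      (fun x => partial b f x * (f x)^-1 + theta0 x b 0).
    by apply: smooth_derivable; exact: smoothD sl (smooth_theta0 b).
  under eq_fun do rewrite etaE mxE.
  rewrite [LHS](congr1 (@^~ 0) (partialM d1 d23)) partial_cst mulr0 addr0.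
  by rewrite (partialD d2 d3) partial_theta0.
rewrite !P (partial_log_derivative 0 2 0 sf f0) => H.
have : (4 * (str_const 4 0 2)%:~R : R) = 4 * (str_const 4 2 0)%:~R by lra.
by rewrite /str_const /=; lra.
Qed.

End ConformalStructure.

Theorem mainTheorem5 (R : realType) :
  exists M : conformal_almost_hermitian R 6, type_W1W2 M /\ ~ is_closed M.
Proof.
by exists (example R); split; [exact: example_type | exact: example_not_closed].
Qed.
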